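(* Let $(X,\mathcal B,m,T)$ be a conservative, ergodic, measure preserving transformation of a $\sigma$-finite measure space, let $\xi\subset\mathcal B$ be a quasi-finite partition, and let $p\in L^1(m)$ with $p>0$ and $\int_Xp\,dm=1$. Then for a.e. $x\in X$, $$\frac1{S_n(p)(x)}\,I(\xi_1^n(T))(x)\longrightarrow\underline h(T,\xi)\qquad(n\to\infty),$$ where $S_n(p)(x):=\sum_{k=0}^{n-1}p(T^kx)$ and $I(\xi_1^n(T))(x):=\log\frac1{m(\xi_1^n(T)(x))}$.
   Context: For a partition $\alpha$ and $x\in X$, $\alpha(x)$ denotes the element of $\alpha$ containing $x$. $\xi_k^\ell(T):=\{\bigcap_{j=k}^{\ell}T^{-j}a_j:\ a_k,\dots,a_\ell\in\xi\}$. For $A\in\mathcal B$ with $0<m(A)<\infty$: $m_A:=m(\cdot\cap A)/m(A)$; $\varphi_A(x):=\min\{n\ge1:T^nx\in A\}$ for $x\in A$; $T_Ax:=T^{\varphi_A(x)}x$ is the induced transformation on $(A,m_A)$; $\rho_A:=\{A\cap T^{-n}A\setminus\bigcup_{j=1}^{n-1}T^{-j}A:\ n\ge1\}$; $H_A(\alpha):=\sum_{a\in\alpha}m_A(a\cap A)\log\frac1{m_A(a\cap A)}$. The set $A$ is quasi finite if $H_A(\rho_A)<\infty$. A countable measurable partition $\xi$ of $X$ is cofinite if there is a set $A=A_\xi$ with $0<m(A)<\infty$ and $A^c\in\xi$; $A$ is called the core of $\xi$. A cofinite partition $\xi$ is quasi-finite if its core $A$ is a quasi finite set and $H_A(\xi)<\infty$.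 For a quasi-finite partition $\xi$ with core $A$, the Krengel entropy is $\underline h(T,\xi):=m(A)\,h(T_A,\rho_A\vee(\xi\cap A))$, where $\xi\cap A$ is the restriction of $\xi$ to $A$ and $h(T_A,\alpha)=\lim_n\frac1nH_A(\bigvee_{j=0}^{n-1}T_A^{-j}\alpha)$ is the usual mean entropy of the partition $\alpha$ under the probability preserving transformation $T_A$ of $(A,m_A)$. (This is the Krengel entropy of $T$ with respect to the factor generated by $\xi$.) If $\xi_1^n(T)(x)$ has infinite measure, $\log\frac1\infty:=-\infty$; for a.e. $x$ this occurs for only finitely many $n$. *)

(* Defs.v *)
From HB Require Import structures.
From mathcomp Require Import all_boot all_order all_algebra.
From mathcomp Require Import all_classical all_reals all_analysis.

Set Implicit Arguments.
Unset Strict Implicit.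
Unset Printing Implicit Defensive.

Import Order.TTheory GRing.Theory Num.Theory.
Import numFieldNormedType.Exports.

Local Open Scope classical_set_scope.
Local Open Scope ring_scope.

Section set_dynamics.
Context {X : Type}.
Implicit Types (T : X -> X) (A : set X) (al be : set (set X)).

(* A partition is a set of subsets of X; the blocks are indexed by themselves. *)

Definition join_partition al be : set (set X) :=
  [set c | exists a b, [/\ al a, be b & c = a `&` b]].

Definition restr_partition al A : set (set X) := [set a `&` A | a in al].

(* The join of the partitions T^{-j} al over j in J. *)
Definition join_over T al (J : set nat) : set (set X) :=
  [set c | exists a : nat -> set X,
     (forall j, J j -> al (a j)) /\
     c = \bigcap_(j in J) (iter j T @^-1` a j)].

(* xi_k^l(T) *)
Definition itinerary T al (k l : nat) : set (set X) :=
  join_over T al [set j | (k <= j <= l)%N].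

(* The junk value 0, taken at points that never return to A, only occurs on a
   null subset of A when T is conservative. *)
Definition return_time T A (x : X) : nat :=
  xget 0%N [set n | [/\ (1 <= n)%N, A (iter n T x) &
    forall k, (1 <= k < n)%N -> ~ A (iter k T x)]].

Definition induced T A (x : X) : X := iter (return_time T A x) T x.

Definition return_partition T A : set (set X) :=
  [set r | exists2 n, (1 <= n)%N &
     r = (A `&` (iter n T @^-1` A)) `\`
         \bigcup_(j in [set j | (1 <= j <= n.-1)%N]) (iter j T @^-1` A)].

Definition birkhoff_sum {R : realType} T (p : X -> R) (n : nat) (x : X) : R :=
  \sum_(0 <= k < n) p (iter k T x).

End set_dynamics.

Section measure_dynamics.
Context {d : measure_display} {X : measurableType d} {R : realType}.
Context (m : {measure set X -> \bar R}).
Implicit Types (T : X -> X) (A : set X) (al xi : set (set X)).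

Definition measure_preserving T : Prop :=
  measurable_fun setT T /\
  forall B, measurable B -> m (T @^-1` B) = m B.

Definition wandering T (W : set X) : Prop :=
  measurable W /\ trivIset setT (fun n => iter n T @^-1` W).

Definition conservative T : Prop := forall W, wandering T W -> m W = 0%E.

Definition ergodic T : Prop :=
  forall B, measurable B -> T @^-1` B = B -> m B = 0%E \/ m (~` B) = 0%E.

(* m_A(B) as a real number; meaningful when 0 < m A < +oo. *)
Definition cond_measure A (B : set X) : R := fine (m (B `&` A)) / fine (m A).

(* H_A(al); the convention 0 log (1/0) = 0 holds as 0^-1 = 0 in R. *)
Definition entropy A al : \bar R :=
  (\esum_(a in al)
     (cond_measure A (a `&` A) * ln (cond_measure A (a `&` A))^-1)%:E)%E.

Definition quasi_finite_set T A : Prop :=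
  [/\ measurable A, (0 < m A < +oo)%E &
      (entropy A (return_partition T A) < +oo)%E].

(* Unlike in the library's [partition], the empty set may be a block: A^c may be
   empty when m is finite. *)
Definition countable_partition xi : Prop :=
  [/\ countable xi, forall a, xi a -> measurable a,
      trivIset xi id & cover xi id = setT].

Definition cofinite_partition xi A : Prop :=
  [/\ countable_partition xi, measurable A, (0 < m A < +oo)%E & xi (~` A)].

Definition quasi_finite_partition T xi A : Prop :=
  [/\ cofinite_partition xi A, quasi_finite_set T A & (entropy A xi < +oo)%E].

(* h(S, al) for a transformation S of (A, m_A). *)
Definition mean_entropy A (S : X -> X) al : \bar R :=
  limn (fun n : nat =>
    ((n%:R^-1)%:E * entropy A (join_over S al [set j | (j < n)%N]))%E).

Definition krengel_entropy T xi A : \bar R :=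
  (m A * mean_entropy A (induced T A)
           (join_partition (return_partition T A) (restr_partition xi A)))%E.

(* In \bar R, (+oo)^-1 = 0 and lne 0 = -oo, so the information is -oo at points
   whose block has infinite measure. *)
Definition information al (x : X) : \bar R := lne ((m (pblock al id x))^-1)%E.

End measure_dynamics.

(* Main.v *)
Require Import Defs.
From mathcomp Require Import all_boot all_order all_algebra.
From mathcomp Require Import all_classical all_reals all_analysis.
From mathcomp Require Import measurable_realfun ring lra zify.
Import Order.TTheory GRing.Theory Num.Theory.
Import numFieldNormedType.Exports.
Local Open Scope classical_set_scope.
Local Open Scope ring_scope.

Set Implicit Arguments.
Unset Strict Implicit.
Unset Printing Implicit Defensive.

(* [charge.v] has an unrelated [induced], which shadows the one meant here. *)
Local Notation induced := Defs.induced.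

(** The induced map [S = T_A] preserves the conditional measure [P] on [A] and is
    ergodic. Label a point by its return time and its [xi]-block; the length-[k]
    [S]-word of the first entrance point of [x] in [A] then squeezes [xi_1^n(x)]
    between two sets differing by one letter, [k] being the number of visits of
    [T x, ..., T^n x] to [A]. The Shannon-McMillan-Breiman theorem for [S] gives
    [I(xi_1^n)(x) ~ k h], and the ratio ergodic theorem gives [k ~ m(A) S_n(p)(x)].

    The Shannon-McMillan-Breiman theorem is deduced from the subadditive ergodic
    theorem, without martingales. Let [mu] be the law of words. Put a subprobability
    [Q] on the words of each length by summing, over all parsings of a word into
    blocks [b], the products of [mu(b) / (|b| (|b| + 1))]. Then [- ln Q] is
    subadditive along orbits, [- ln Q <= - ln mu + O(ln n)] is trivial, and the
    converse almost everywhere bound is Borel-Cantelli. *)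

(** * Maximal and ratio ergodic theorems *)

(** The word information is in general not subadditive along orbits, since [mu (s ++ t)] can be far
    below [mu s * mu t]. Passing to [Q] cures this at logarithmic cost, because parsings of two
    words concatenate. As [- ln Q] and the information are close both pointwise and in mean, one
    number is the almost everywhere limit and the limit of the normalised entropies. The measure [m]
    may be infinite, while [P] sees only [A]; what is known for [S] reaches a general [x] only
    through its entrance point [S x]. The upper bound for the measure of the block of [x] is then
    immediate from invariance of [m]. The lower bound is not: the points that enter [A] after a
    given time may be under-represented on a given word. It holds almost everywhere up to a factor
    [k ^ 2], whose logarithm is negligible against [k]. *)

Section measure_preserving_maps.
Context {d : measure_display} {X : measurableType d} {R : realType}.
Context {m : {measure set X -> \bar R}} {S : X -> X}.
Hypothesis Smp : measure_preserving m S.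

Lemma measurable_iter n : measurable_fun setT (iter n S).
Proof.
elim: n => [|n IH]; first exact: measurable_id.
by rewrite iterfS; apply: measurableT_comp; [exact: Smp.1 | exact: IH].
Qed.

Lemma measurable_preimage_iter n B : measurable B -> measurable (iter n S @^-1` B).
Proof. by move=> mB; rewrite -[X in measurable X]setTI; exact: measurable_iter. Qed.

Lemma measure_preimage_iter n B : measurable B -> m (iter n S @^-1` B) = m B.
Proof.
move=> mB; elim: n => // n IH.
have -> : iter n.+1 S @^-1` B = S @^-1` (iter n S @^-1` B).
  by rewrite iterfSr.
by rewrite Smp.2//; exact: measurable_preimage_iter.
Qed.

Lemma negligible_preimage_iter n B :
  m.-negligible B -> m.-negligible (iter n S @^-1` B).
Proof.
case=> N [mN N0 BN]; exists (iter n S @^-1` N); split.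
- exact: measurable_preimage_iter.
- by rewrite measure_preimage_iter.
- by move=> x /=; exact: BN.
Qed.

Lemma ge0_integral_iter n (f : X -> \bar R) :
  measurable_fun setT f -> (forall x, 0 <= f x)%E ->
  (\int[m]_x f (iter n S x) = \int[m]_x f x)%E.
Proof.
move=> mf f0; pose mS := measurable_iter n.
rewrite -[LHS](ge0_integral_pushforward mS m measurableT mf)//.
apply: eq_measure_integral => B mB _.
exact: measure_preimage_iter.
Qed.

Lemma integrable_iter n (f : X -> \bar R) :
  m.-integrable setT f -> m.-integrable setT (f \o iter n S).
Proof.
move=> /integrableP[mf fi]; apply/integrableP; split.
  by apply: measurableT_comp => //; exact: measurable_iter.
rewrite (ge0_integral_iter n (f := fun x => `|f x|%E))//.
exact: measurableT_comp.
Qed.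

Lemma integral_iter n (f : X -> \bar R) : m.-integrable setT f ->
  (\int[m]_x f (iter n S x) = \int[m]_x f x)%E.
Proof.
move=> /integrableP[mf _]; rewrite integralE [RHS]integralE.
congr (_ - _)%E.
- rewrite -[RHS](ge0_integral_iter n)//; last exact: measurable_funepos.
  by apply: eq_integral => x _; rewrite !funeposE.
- rewrite -[RHS](ge0_integral_iter n)//; last exact: measurable_funeneg.
  by apply: eq_integral => x _; rewrite !funenegE.
Qed.

End measure_preserving_maps.

Section maximal_ergodic.
Context {d : measure_display} {X : measurableType d} {R : realType}.
Context {m : {measure set X -> \bar R}} {S : X -> X}.

(* [max_birkhoff f n x] is the maximum of 0 and the first n Birkhoff sums at x. *)
Fixpoint max_birkhoff (f : X -> R) n x : R :=
  if n is k.+1 then Num.max 0 (f x + max_birkhoff f k (S x)) else 0.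

Lemma max_birkhoff_ge0 (f : X -> R) n x : 0 <= max_birkhoff f n x.
Proof. by case: n => //= n; rewrite le_max lexx. Qed.

Lemma max_birkhoff_leS (f : X -> R) n x : max_birkhoff f n x <= max_birkhoff f n.+1 x.
Proof.
elim: n x => [|n IH] x; first exact: max_birkhoff_ge0.
rewrite [leLHS]/= [leRHS]/=; apply: le_max2 => //.
by rewrite lerD2l IH.
Qed.

Lemma birkhoff_sumSl (f : X -> R) n x :
  birkhoff_sum S f n.+1 x = f x + birkhoff_sum S f n (S x).
Proof.
rewrite /birkhoff_sum big_nat_recl//=; congr (_ + _).
by apply: eq_bigr => i _; rewrite -iterS iterSr.
Qed.

Lemma birkhoff_sumSr (f : X -> R) n x :
  birkhoff_sum S f n.+1 x = birkhoff_sum S f n x + f (iter n S x).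
Proof. by rewrite /birkhoff_sum big_nat_recr. Qed.

Lemma birkhoff_sum_le_max (f : X -> R) n x : birkhoff_sum S f n x <= max_birkhoff f n x.
Proof.
elim: n x => [|n IH] x; first by rewrite /birkhoff_sum big_geq.
by rewrite birkhoff_sumSl/= le_max lerD2l IH orbT.
Qed.

Hypothesis Smp : measure_preserving m S.

Lemma integrable_max_birkhoff (f : X -> R) n : m.-integrable setT (EFin \o f) ->
  m.-integrable setT (EFin \o max_birkhoff f n).
Proof.
move=> fi; elim: n => [|n IH]; first exact: integrable0.
have mM k : measurable_fun setT (max_birkhoff f k).
  have mf : measurable_fun setT f by apply/measurable_EFinP; exact: measurable_int fi.
  elim: k => [|k IHk] /=; first exact: measurable_cst.
  apply: measurable_maxr; first exact: measurable_cst.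
  by apply: measurable_funD => //; apply: measurableT_comp => //; exact: Smp.1.
apply: (@le_integrable _ _ _ m _ measurableT _
   (fun x => ((EFin \o f) \+ ((EFin \o max_birkhoff f n) \o iter 1 S)) x)).
- exact/measurable_EFinP.
- move=> x _ /=; rewrite lee_fin -/(max_birkhoff f n) ger0_norm ?le_max ?lexx//.
  by rewrite ge_max normr_ge0 ler_norm.
- by apply: integrableD => //; exact: integrable_iter.
Qed.

(** Garsia's argument: where [max_birkhoff f n.+1] is positive, [f] equals it minus
    [max_birkhoff f n] composed with [S]. The integral of this difference is nonnegative since the
    maxima increase with [n] and [S] preserves [m]. *)
Lemma maximal_ergodic (f : X -> R) n : m.-integrable setT (EFin \o f) ->
  (0 <= \int[m]_(x in [set x | (0 < max_birkhoff f n x)%R]) (f x)%:E)%E.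
Proof.
move=> fi; case: n => [|n].
  rewrite [X in integral _ X](_ : _ = set0) ?integral_set0//.
  by apply/seteqP; split => x //=; rewrite ltxx.
have Mi k := integrable_max_birkhoff k fi.
have mM k : measurable_fun setT (max_birkhoff f k).
  by apply/measurable_EFinP; exact: measurable_int (Mi k).
set E := [set x | _].
have mE : measurable E.
  have := @measurable_fun_ltr _ X R setT (cst 0) (max_birkhoff f n.+1)
    (measurable_cst _) (mM _) measurableT [set true] I.
  by rewrite setTI; congr measurable; apply/seteqP; split => x /=.
rewrite (eq_integral (fun x =>
  (max_birkhoff f n.+1 x)%:E - (max_birkhoff f n (iter 1 S x))%:E)%E); last first.
  move=> x; rewrite inE /E/= => h; rewrite -EFinB; congr (_%:E).
  have : Num.max 0 (f x + max_birkhoff f n (S x)) = f x + max_birkhoff f n (S x).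
    by apply: max_r; move: h; rewrite lt_max ltxx/= => /ltW.
  by move=> ->; rewrite addrK.
have MSi := integrable_iter Smp 1 (Mi n).
rewrite integralB_EFin//; [|exact: integrableS (Mi _)|exact: integrableS MSi].
rewrite sube_ge0; last first.
  apply/orP; right; apply: integrable_fin_num => //; exact: integrableS (Mi _).
have -> : (\int[m]_(x in E) (max_birkhoff f n.+1 x)%:E =
    \int[m]_x (max_birkhoff f n.+1 x)%:E)%E.
  rewrite integral_mkcond; apply: eq_integral => x _; rewrite patchE.
  case: ifPn => //; rewrite notin_setE /E/= => /negP; rewrite -leNgt => h.
  by congr (_%:E); apply/eqP; rewrite eq_le h andbT; exact: (max_birkhoff_ge0 f n.+1).
apply: (@le_trans _ _ (\int[m]_x (max_birkhoff f n (iter 1 S x))%:E)%E).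
  apply: ge0_subset_integral => //.
    exact: measurable_int MSi.
  by move=> x _; rewrite lee_fin max_birkhoff_ge0.
rewrite (integral_iter Smp 1 (Mi n)).
apply: ge0_le_integral => //.
- by move=> x _; rewrite lee_fin max_birkhoff_ge0.
- exact: measurable_int (Mi n).
- exact: measurable_int (Mi n.+1).
- by move=> x _; rewrite lee_fin max_birkhoff_leS.
Qed.

Hypothesis Serg : ergodic m S.

(* The set where the partial maxima are unbounded is strictly invariant; were it
   conull, the maximal inequality would give a nonnegative integral. *)
Lemma birkhoff_sum_bounded (f : X -> R) : m.-integrable setT (EFin \o f) ->
  (\int[m]_x (f x)%:E < 0)%E ->
  {ae m, forall x, exists K : R, forall n, birkhoff_sum S f n x <= K}.
Proof.
move=> fi f0.
have Mi k := integrable_max_birkhoff k fi.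
have mM k : measurable_fun setT (max_birkhoff f k).
  by apply/measurable_EFinP; exact: measurable_int (Mi k).
pose D := [set x | forall K : nat, exists n, K%:R < max_birkhoff f n x].
have mD : measurable D.
  rewrite [X in measurable X](_ : D = \bigcap_K \bigcup_n
     [set x | (K%:R < max_birkhoff f n x)]); last first.
    apply/seteqP; split => x; first by move=> h K _; have [n hn] := h K; exists n.
    by move=> h K; have [n _ hn] := h K I; exists n.
  apply: bigcapT_measurable => K; apply: bigcupT_measurable => n.
  have := @measurable_fun_ltr _ X R setT (cst K%:R) (max_birkhoff f n)
    (measurable_cst _) (mM _) measurableT [set true] I.
  by rewrite setTI; congr measurable; apply/seteqP; split => x /=.
have SD : S @^-1` D = D.
  clear f0; apply/seteqP; split => x /= h K.
  (* Raising the threshold by more than [|f x|] absorbs the one term by which the maxima at [x] and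
     at [S x] differ. *)
  - have [n hn] := h (K + Num.trunc `|f x|).+1.
    exists n.+1 => /=; rewrite lt_max; apply/orP; right.
    have := truncnS_gt `|f x|; have := ler_norm (- f x); rewrite normrN => h1 h2.
    move: hn; rewrite -addn1 -addnA natrD addn1 => hn.
    by lra.
  - have [n hn] := h (K + Num.trunc `|f x|).+1.
    have := truncnS_gt `|f x|; have := ler_norm (f x) => h1 h2.
    move: hn; rewrite -addn1 -addnA natrD addn1 => hn.
    have K0 : 0 <= K%:R :> R by [].
    have := normr_ge0 (f x) => h3.
    case: n hn => [|n] /= hn; first by lra.
    by exists n; move: hn; rewrite lt_max => /orP[|]; lra.
have [D0|D0] := Serg mD SD.
- exists D; split => // x /= h K; apply: contrapT => h'; apply: h; exists K%:R => n.
  rewrite (le_trans (birkhoff_sum_le_max _ _ _))// leNgt; apply/negP => h''.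
  by apply: h'; exists n.
- exfalso.
  pose E n := [set x | (0 < max_birkhoff f n x)].
  have mE n : measurable (E n).
    have := @measurable_fun_ltr _ X R setT (cst 0) (max_birkhoff f n)
      (measurable_cst _) (mM _) measurableT [set true] I.
    by rewrite setTI; congr measurable; apply/seteqP; split => x /=.
  have fin0 n := maximal_ergodic n fi.
  have mf : measurable_fun setT (EFin \o f) by exact: measurable_int fi.
  (* Every point of [D] lies in [E n] for all large [n], so [f] restricted to [E n] converges to [f]
     almost everywhere. *)
  have := @dominated_convergence _ X R m setT measurableT
    (fun n => (EFin \o f) \_ (E n)) (EFin \o f) (fun x => `|(EFin \o f) x|%E).
  case => //.
  + move=> n; apply/(measurable_restrictT (EFin \o f)) => //; exact: measurable_funTS.
  + exists (~` D); split => //; first exact: measurableC.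
    move=> x /= h Dx; apply: h => _; apply: cvg_near_cst.
    have [n hn] := Dx 0%N; exists n => // k /= nk.
    rewrite patchE ifT// inE /E/=; apply: lt_le_trans hn _.
    have /nondecreasing_seqP : forall k, (max_birkhoff f)^~ x k <= (max_birkhoff f)^~ x k.+1.
      by move=> j; exact: max_birkhoff_leS.
    exact.
  + exact: integrable_abse.
  + apply: aeW => x n _; rewrite patchE; case: ifPn => // _.
    by rewrite abse0 abse_ge0.
  + move=> _ _ cvgE; have : (0 <= \int[m]_x (f x)%:E)%E.
      rewrite -(cvg_lim _ cvgE)//; apply: lime_ge; first exact: cvgP cvgE.
      by apply: nearW => n /=; rewrite -integral_mkcond; exact: fin0.
    by rewrite leNgt f0.
Qed.

End maximal_ergodic.

Section ratio_ergodic.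
Context {d : measure_display} {X : measurableType d} {R : realType}.
Context {m : {measure set X -> \bar R}} {S : X -> X}.
Hypothesis Smp : measure_preserving m S.
Hypothesis Serg : ergodic m S.
Implicit Types f g : X -> R.

(** The function [f - c g] has negative integral, so its Birkhoff sums are bounded above. The bound
    [K] depends on the point and is harmless once divided by divergent sums. *)
Lemma birkhoff_sum_le_scale f g (c : R) :
  m.-integrable setT (EFin \o f) -> m.-integrable setT (EFin \o g) ->
  (\int[m]_x (f x)%:E < c%:E * \int[m]_x (g x)%:E)%E ->
  {ae m, forall x, exists K : R, forall n,
    birkhoff_sum S f n x <= c * birkhoff_sum S g n x + K}.
Proof.
move=> fi gi fg; pose h x := f x - c * g x.
have cgi : m.-integrable setT (EFin \o (fun x => c * g x)).
  apply: (eq_integrable measurableT _ _ _ (integrableZl measurableT c gi)).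
  by move=> x _ /=; rewrite EFinM.
have hi : m.-integrable setT (EFin \o h).
  apply: (eq_integrable measurableT _ _ _ (integrableB measurableT fi cgi)).
  by move=> x _ /=; rewrite -EFinB.
have h0 : (\int[m]_x (h x)%:E < 0)%E.
  under eq_integral do rewrite /h EFinB.
  rewrite integralB_EFin//; under [X in (_ - X)%E]eq_integral do rewrite EFinM.
  rewrite integralZl// sube_lt0//.
  by apply/orP; left; exact: integrable_fin_num.
have hS n x : birkhoff_sum S h n x = birkhoff_sum S f n x - c * birkhoff_sum S g n x.
  by rewrite /birkhoff_sum /h big_split/= sumrN mulr_sumr.
apply: filterS (birkhoff_sum_bounded Smp Serg hi h0) => x [K HK].
by exists K => n; rewrite -lerBlDl -hS.
Qed.

(** The one-sided bound is applied to [f] and to [- f] with slopes [1 / (j + 1)] above the ratio of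
    the integrals; countably many slopes keep the exceptional set null. *)
Lemma birkhoff_ratio_cvg f g :
  m.-integrable setT (EFin \o f) -> m.-integrable setT (EFin \o g) ->
  (\int[m]_x (g x)%:E = 1)%E ->
  {ae m, forall x, birkhoff_sum S g n x @[n --> \oo] --> +oo} ->
  {ae m, forall x, birkhoff_sum S f n x / birkhoff_sum S g n x @[n --> \oo] -->
     fine (\int[m]_x (f x)%:E)%E}.
Proof.
move=> fi gi g1 goo; set a := fine _.
have aE : (\int[m]_x (f x)%:E = a%:E)%E.
  by rewrite fineK//; exact: integrable_fin_num.
have Nfi : m.-integrable setT (EFin \o (fun x => - f x)).
  apply: (eq_integrable measurableT _ _ _ (integrableN fi)).
  by move=> x _ /=; rewrite EFinN.
have H1 j := @birkhoff_sum_le_scale f g (a + j.+1%:R^-1) fi gi.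
have H2 j := @birkhoff_sum_le_scale (fun x => - f x) g (- a + j.+1%:R^-1) Nfi gi.
have {}H1 : {ae m, forall x, forall j : nat, exists K : R, forall n,
    birkhoff_sum S f n x <= (a + j.+1%:R^-1) * birkhoff_sum S g n x + K}.
  apply: ae_foralln => j; apply: H1.
  by rewrite aE g1 mule1 lte_fin ltrDl invr_gt0.
have {}H2 : {ae m, forall x, forall j : nat, exists K : R, forall n,
    birkhoff_sum S (fun x => - f x) n x <= (- a + j.+1%:R^-1) * birkhoff_sum S g n x + K}.
  apply: ae_foralln => j; apply: H2.
  under eq_integral do rewrite EFinN.
  rewrite integralN; last exact: integrable_add_def.
  by rewrite aE g1 mule1 -EFinN lte_fin ltrDl invr_gt0.
apply: filterS3 goo H1 H2 => x gx K1 K2.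
apply/cvgrPdist_le => e e0.
have [j je] : exists j : nat, j.+1%:R^-1 <= e / 2.
  exists (Num.trunc (2 / e)); rewrite invf_ple ?posrE ?divr_gt0//.
  by rewrite invf_div; apply/ltW/truncnS_gt.
have [k1 hk1] := K1 j; have [k2 hk2] := K2 j.
(* Past this threshold each additive constant is below [e / 2] times the denominator; the summand
   [e] keeps the denominator positive even if both constants vanish. *)
have [N _ gN] : \forall n \near \oo,
    2 / e * (`|k1| + `|k2| + e) < birkhoff_sum S g n x.
  by move/cvgryPgt : gx; exact.
exists N => // n /= Nn; have {}gN := gN n Nn.
have {hk1} := hk1 n; have {hk2} := hk2 n.
have -> : birkhoff_sum S (fun y => - f y) n x = - birkhoff_sum S f n x.
  by rewrite /birkhoff_sum sumrN.
move: gN; move: (birkhoff_sum S g n x) (birkhoff_sum S f n x) => u v.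
move=> hu h2 h1.
have k1n := ler_norm k1; have k2n := ler_norm k2.
have k1p := normr_ge0 k1; have k2p := normr_ge0 k2.
have hu' : `|k1| + `|k2| + e < u * (e / 2).
  by rewrite -ltr_pdivrMr ?divr_gt0// invf_div mulrC.
have e2 : 0 < e / 2 by lra.
have u0 : 0 < u by rewrite -(pmulr_lgt0 _ e2); lra.
have iu : j.+1%:R^-1 * u <= e / 2 * u by rewrite ler_pM2r.
have [w vE] : exists w, v = w * u by exists (v / u); rewrite divfK ?gt_eqF.
move: h1 h2; rewrite vE mulfK ?gt_eqF// => h1 h2.
move: h1 h2 iu; move: (j.+1%:R^-1) => i h1 h2 iu.
have -> : a - w = ((a - w) * u) / u by rewrite mulfK ?gt_eqF.
by rewrite ler_norml ler_pdivlMr// ler_pdivrMr//; apply/andP; split; lra.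
Qed.

End ratio_ergodic.

(** * Subadditive ergodic theorem *)

Section subadditive_ergodic.
Context {d : measure_display} {X : measurableType d} {R : realType}.
Context {P : probability X R} {S : X -> X}.
Hypothesis Smp : measure_preserving P S.
Hypothesis Serg : ergodic P S.

(** The preimages of [L] under the iterates decrease. Their intersection is strictly invariant and,
    as [P] is finite, still has the measure of [L]. *)
Lemma ergodic_sub_invariant L : measurable L -> S @^-1` L `<=` L ->
  P L = 0%E \/ P (~` L) = 0%E.
Proof.
move=> mL SL; pose B := \bigcap_n (iter n S @^-1` L).
have mI n : measurable (iter n S @^-1` L) by apply: measurable_preimage_iter Smp _ _ mL.
have mB : measurable B by exact: bigcapT_measurable.
have BL : B `<=` L by move=> x /(_ 0%N I).
have SB : S @^-1` B = B.
  apply/seteqP; split => x /= h n _.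
    case: n => [|n]; first by apply: SL; exact: (h 0%N I).
    by have /= := h n I; rewrite -iterS iterSr.
  by have /= := h n.+1 I; rewrite -iterS iterSr.
have PB : P B = P L.
  have /cvg_lim <-// : P \o (fun n => iter n S @^-1` L) @ \oo --> P B.
    apply: nonincreasing_cvg_mu => //.
      by rewrite (le_lt_trans (probability_le1 P (mI 0%N)))// ltry.
    apply/nonincreasing_seqP => n; apply/subsetPset => x.
    elim: n x => [|n IH] x; first exact: SL.
    by rewrite /preimage/mkset iterSr => /IH; rewrite /preimage/mkset -iterSr.
  rewrite (_ : _ \o _ = cst (P L)) ?lim_cst//.
  by apply/funext => n /=; rewrite measure_preimage_iter.
have [B0|B0] := Serg mB SB; [left|right]; first by rewrite -PB.
apply/eqP; rewrite eq_le measure_ge0 andbT -B0.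
by apply: le_measure; rewrite ?inE; [exact: measurableC..|exact: subsetC].
Qed.

Lemma integrable_cst1 : P.-integrable setT (EFin \o (cst 1 : X -> R)).
Proof. exact: finite_measure_integrable_cst. Qed.

Lemma integral_cst1 : (\int[P]_x ((cst 1 : X -> R) x)%:E = 1)%E.
Proof. by rewrite (integral_cst P measurableT 1)// mul1e; exact: probability_setT. Qed.

Lemma birkhoff_sum_cst1 n x : birkhoff_sum S (cst 1) n x = n%:R :> R.
Proof. by rewrite /birkhoff_sum big_const_nat subn0 iter_addr_0. Qed.

Lemma birkhoff_sum_le_lin (f : X -> R) (c : R) : P.-integrable setT (EFin \o f) ->
  (\int[P]_x (f x)%:E < c%:E)%E ->
  {ae P, forall x, exists K : R, forall n, birkhoff_sum S f n x <= c * n%:R + K}.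
Proof.
move=> fi fc.
have := @birkhoff_sum_le_scale _ X R P S Smp Serg f (cst 1) c fi integrable_cst1.
rewrite integral_cst1 mule1 => /(_ fc); apply: filterS => x [K HK].
by exists K => n; rewrite -(birkhoff_sum_cst1 n x).
Qed.

(** The value at time [n] is a difference of consecutive Birkhoff sums; the longer is bounded above
    with slope [a + e / 2], the shorter below with slope [a - e / 2], where [a] is the mean of
    [f]. *)
Lemma orbit_sublinear (f : X -> R) (e : R) : P.-integrable setT (EFin \o f) -> 0 < e ->
  {ae P, forall x, exists K : R, forall n, f (iter n S x) <= e * n%:R + K}.
Proof.
move=> fi e0; set a := fine (\int[P]_x (f x)%:E)%E.
have aE : (\int[P]_x (f x)%:E = a%:E)%E.
  by rewrite fineK//; exact: integrable_fin_num.
have Nfi : P.-integrable setT (EFin \o (fun x => - f x)).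
  apply: (eq_integrable measurableT _ _ _ (integrableN fi)).
  by move=> x _ /=; rewrite EFinN.
have H1 : {ae P, forall x, exists K : R, forall n,
    birkhoff_sum S f n x <= (a + e / 2) * n%:R + K}.
  by apply: birkhoff_sum_le_lin => //; rewrite aE lte_fin; lra.
have H2 : {ae P, forall x, exists K : R, forall n,
    birkhoff_sum S (fun x => - f x) n x <= (- a + e / 2) * n%:R + K}.
  apply: birkhoff_sum_le_lin => //; under eq_integral do rewrite EFinN.
  rewrite integralN; last exact: integrable_add_def.
  by rewrite aE -EFinN lte_fin; lra.
apply: filterS2 H1 H2 => x [K1 hK1] [K2 hK2].
exists (a + e / 2 + K1 + K2) => n.
have := hK1 n.+1; have := hK2 n.
have -> : birkhoff_sum S (fun y => - f y) n x = - birkhoff_sum S f n x.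
  by rewrite /birkhoff_sum sumrN.
rewrite birkhoff_sumSr -[n.+1%:R]natr1; move: (birkhoff_sum _ _ _ _) (n%:R) => u v h1 h2.
by lra.
Qed.

Lemma integral_orbit_sum (f : X -> R) (r : seq nat) :
  measurable_fun setT f -> (forall x, 0 <= f x) ->
  (\int[P]_x (\sum_(t <- r) f (iter t S x))%:E =
   (size r)%:R%:E * \int[P]_x (f x)%:E)%E.
Proof.
move=> mf f0; under eq_integral do rewrite -sumEFin.
have mfi t : measurable_fun setT (fun x => (f (iter t S x))%:E).
  by apply/measurable_EFinP; apply: measurableT_comp => //; exact: (measurable_iter Smp).
rewrite (@ge0_integral_sum _ _ _ P _ measurableT _ (fun t x => (f (iter t S x))%:E))//;
  last by move=> t x _; rewrite lee_fin.
under eq_bigr => t _.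
  rewrite (ge0_integral_iter Smp t (f := fun x => (f x)%:E))//; last first.
    by apply/measurable_EFinP.
  over.
rewrite big_const_seq count_predT; move: (integral _ _ _) => I.
elim: (size r) => [|k IH] /=; first by rewrite mul0e.
by rewrite IH -nat1r EFinD ge0_muleDl ?lee_fin// mul1e.
Qed.

Variable J : nat -> X -> R.
Hypothesis J_ge0 : forall n x, 0 <= J n x.
Hypothesis J0 : forall x, J 0 x = 0.
Hypothesis J_sub : forall a b x, J (a + b)%N x <= J a x + J b (iter a S x).
Hypothesis mJ : forall n, measurable_fun setT (J n).
Hypothesis J1_int : P.-integrable setT (EFin \o J 1).

Lemma subadditive_le_sum n x : J n x <= birkhoff_sum S (J 1) n x.
Proof.
elim: n => [|n IH]; first by rewrite J0 /birkhoff_sum big_geq.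
by rewrite birkhoff_sumSr -addn1 (le_trans (J_sub _ _ _))// lerD2r.
Qed.

Lemma subadditive_integrable n : P.-integrable setT (EFin \o J n).
Proof.
have : P.-integrable setT (EFin \o birkhoff_sum S (J 1) n).
  apply: (eq_integrable measurableT (fun x => \sum_(0 <= t < n) (J 1 (iter t S x))%:E)%E).
    by move=> x _ /=; rewrite sumEFin.
  apply: (integrable_sum measurableT) => t _.
  exact: (integrable_iter Smp t J1_int).
apply: le_integrable => //; first exact/measurable_EFinP.
move=> x _ /=; rewrite lee_fin !ger0_norm//; first exact: subadditive_le_sum.
by rewrite /birkhoff_sum sumr_ge0.
Qed.

Definition mean_sub n : R := fine (\int[P]_x (J n x)%:E)%E.

Lemma mean_subE n : (\int[P]_x (J n x)%:E = (mean_sub n)%:E)%E.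
Proof. by rewrite fineK//; apply: integrable_fin_num => //; exact: subadditive_integrable. Qed.

Lemma mean_sub_ge0 n : 0 <= mean_sub n.
Proof. by apply: fine_ge0; apply: integral_ge0 => x _; rewrite lee_fin. Qed.

(** Length 0 is left out: division by 0 gives 0 there, which would pull the infimum down to 0. *)
Definition rate : R := inf [set mean_sub k.+1 / k.+1%:R | k in setT].

Lemma rate_le k : rate <= mean_sub k.+1 / k.+1%:R.
Proof.
apply: ge_inf; last by exists k.
by exists 0 => _ [j _ <-]; rewrite divr_ge0// mean_sub_ge0.
Qed.

Lemma rate_ge0 : 0 <= rate.
Proof.
apply: lb_le_inf; first by exists (mean_sub 1 / 1%:R); exists 0%N.
by move=> _ [j _ <-]; rewrite divr_ge0// mean_sub_ge0.
Qed.

(* Averaging over the k phases: the sum of k consecutive terms has increments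
   J (n + k) - J n <= J k \o S^n. *)
Lemma subadditive_le_rate (c : R) : rate < c ->
  {ae P, forall x, exists K : R, forall n, J n x <= c * n%:R + K}.
Proof.
move=> /[dup] rc /inf_lt [|_ [k0 _ <-]].
  by exists (mean_sub 1 / 1%:R); exists 0%N.
set k := k0.+1; have k1 : (0 : R) < k%:R by [].
rewrite ltr_pdivrMr// => ekc.
have [c' /andP[ec' cc']] : exists c', (mean_sub k < c' * k%:R) && (c' < c).
  exists ((mean_sub k / k%:R + c) / 2).
  have h : mean_sub k / k%:R < c by rewrite ltr_pdivrMr.
  rewrite -ltr_pdivrMr//; lra.
(* The [k] one-step terms in [JV] cost [e * n] each up to constants, so together they use up exactly
   the gap between [c'] and [c]. *)
pose e := (c - c') / k%:R.
have e0 : 0 < e by rewrite divr_gt0 ?subr_gt0.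
have H1 : {ae P, forall x, exists K : R, forall n,
    birkhoff_sum S (J k) n x <= c' * k%:R * n%:R + K}.
  by apply: birkhoff_sum_le_lin; [exact: subadditive_integrable|rewrite mean_subE lte_fin].
apply: filterS2 H1 (orbit_sublinear J1_int e0) => x [K1 hK1] [K2 hK2].
pose V n := \sum_(0 <= s < k) J (n + s)%N x.
have VS n : V n <= V 0%N + birkhoff_sum S (J k) n x.
  elim: n => [|n IH]; first by rewrite /birkhoff_sum big_geq// addr0.
  rewrite birkhoff_sumSr addrA; apply: le_trans (lerD IH (lexx _)).
  have -> : V n.+1 = \sum_(0 <= s < k0) J (n + s.+1)%N x + J (n + k)%N x.
    rewrite /V big_nat_recr//= addSnnS; congr (_ + _).
    by apply: eq_bigr => s _; rewrite addSnnS.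
  have -> : V n = J n x + \sum_(0 <= s < k0) J (n + s.+1)%N x.
    by rewrite /V big_nat_recl// addn0.
  have := J_sub n k x; lra.
(* Each of the [k] phases is prolonged from [n + s] to [n + k] by one-step terms; by nonnegativity
   these are bounded by the full sum over [t < k]. *)
have JV n : k%:R * J (n + k)%N x <= V n +
    k%:R * \sum_(0 <= t < k) J 1 (iter (n + t) S x).
  rewrite /V !mulr_natl.
  rewrite -[k in _ *+ k]subn0 -sumr_const_nat.
  rewrite -[k in X in _ + _ *+ X]subn0 -sumr_const_nat.
  apply: (@le_trans _ _ (\sum_(0 <= s < k) (J (n + s)%N x +
      \sum_(0 <= t < k) J 1 (iter (n + t) S x)))); last by rewrite big_split.
  rewrite big_nat [leRHS]big_nat; apply: ler_sum => s /andP[_ sk].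
  have -> : (n + k = (n + s) + (k - s))%N by rewrite -addnA subnKC// ltnW.
  rewrite (le_trans (J_sub _ _ _))// lerD2l (le_trans (subadditive_le_sum _ _))//.
  rewrite /birkhoff_sum (big_cat_nat (leq0n s) (ltnW sk))/=.
  have -> : \sum_(s <= t < k) J 1 (iter (n + t) S x) =
      \sum_(0 <= t < k - s) J 1 (iter t S (iter (n + s) S x)).
    rewrite -{1}[s]add0n big_addn; apply: eq_bigr => t _.
    by rewrite -iterD addnCA [(t + _)%N]addnC -addnA.
  by rewrite lerDr sumr_ge0.
pose M := (K1 + V 0%N) / k%:R + k%:R * (e * k%:R + K2).
have Jnk n : J (n + k)%N x <= c * n%:R + M.
  have JVn := JV n; have VSn := VS n; have hK1n := hK1 n.
  have sumK : \sum_(0 <= t < k) J 1 (iter (n + t) S x) <=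
      (e * n%:R + e * k%:R + K2) *+ k.
    rewrite -[k in leRHS]subn0 -sumr_const_nat !big_nat; apply: ler_sum => t /andP[_ tk].
    rewrite (le_trans (hK2 _))// lerD2r -mulrDr ler_pM2l// -natrD ler_nat leq_add2l.
    exact: ltnW.
  have ek : e * k%:R = c - c' by rewrite /e divfK ?gt_eqF.
  rewrite -(ler_pM2l k1) (le_trans JVn)//.
  move: sumK; rewrite -mulr_natl -(ler_pM2l k1) => sumK.
  have -> : k%:R * (c * n%:R + M) = c' * k%:R * n%:R + K1 + V 0%N +
      k%:R * (k%:R * (e * n%:R + e * k%:R + K2)).
    rewrite /M (_ : c = c' + e * k%:R); last by rewrite ek addrC subrK.
    by field; rewrite gt_eqF.
  by move: JVn sumK; lra.
have kS : 0 <= birkhoff_sum S (J 1) k x by rewrite /birkhoff_sum sumr_ge0.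
exists (`|M| + birkhoff_sum S (J 1) k x) => n.
have c0 : 0 <= c by apply: le_trans rate_ge0 _; lra.
have [kn|nk] := leqP k n.
  rewrite -{1}(subnK kn) (le_trans (Jnk _))// natrB//.
  have := ler_norm M; have := mulr_ge0 c0 (ltW k1); lra.
rewrite (le_trans (subadditive_le_sum _ _))//.
have : birkhoff_sum S (J 1) n x <= birkhoff_sum S (J 1) k x.
  by rewrite /birkhoff_sum (big_cat_nat (leq0n n) (ltnW nk))//= lerDl sumr_ge0.
have n0 : (0 : R) <= n%:R by [].
have := normr_ge0 M; have := mulr_ge0 c0 n0; lra.
Qed.

(** The orbit segment is cut from the left. Outside [B] one jumps over a block of length at most [L]
    and cost at most [c] per step; at a point of [B] one moves a single step and pays [J 1]. In the
    last [L] steps a block might overshoot, so every step there is paid by [J 1]. *)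
Lemma greedy_bound (c : R) (L : nat) (B : set X) : 0 <= c -> (0 < L)%N ->
  (forall x, ~ B x -> exists2 n, (0 < n <= L)%N & J n x <= c * n%:R) ->
  forall N x, J N x <= c * N%:R + \sum_(0 <= t < N) (J 1 \_ B) (iter t S x) +
    \sum_(N - L <= t < N) J 1 (iter t S x).
Proof.
move=> c0 L0 HB.
have g0 y : 0 <= (J 1 \_ B) y by rewrite patchE; case: ifPn.
elim/ltn_ind => N IH x; have [NL|LN] := leqP N L.
  have -> : (N - L = 0)%N by apply/eqP; rewrite subn_eq0.
  rewrite (le_trans (subadditive_le_sum _ _))// lerDr addr_ge0//; first exact: mulr_ge0.
  by rewrite sumr_ge0.
have tail n : (n < N)%N -> (n <= L)%N ->
    \sum_(N - n - L <= t < N - n) J 1 (iter t S (iter n S x)) =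
    \sum_(N - n - L + n <= t < N) J 1 (iter t S x).
  move=> nN nL; rewrite -{2}(subnK (ltnW nN)) big_addn addnK.
  by apply: eq_bigr => t _; rewrite iterD.
have head n : (n < N)%N -> (n <= L)%N ->
    \sum_(0 <= t < N - n) (J 1 \_ B) (iter t S (iter n S x)) =
    \sum_(n <= t < N) (J 1 \_ B) (iter t S x).
  move=> nN nL; symmetry; rewrite -{1}[n]add0n big_addn.
  by apply: eq_bigr => t _; rewrite iterD.
have tail_le n : (n < N)%N -> (n <= L)%N ->
    \sum_(N - n - L + n <= t < N) J 1 (iter t S x) <=
    \sum_(N - L <= t < N) J 1 (iter t S x).
  move=> nN nL; rewrite [leRHS](@big_cat_nat _ _ _ (N - n - L + n))/=; [|lia|lia].
  by rewrite lerDr sumr_ge0.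
have main n : (0 < n)%N -> (n < N)%N -> (n <= L)%N ->
    J n x <= c * n%:R + \sum_(0 <= t < n) (J 1 \_ B) (iter t S x) ->
    J N x <= c * N%:R + \sum_(0 <= t < N) (J 1 \_ B) (iter t S x) +
      \sum_(N - L <= t < N) J 1 (iter t S x).
  move=> n0 nN nL Jn; rewrite -{1}(subnKC (ltnW nN)) (le_trans (J_sub _ _ _))//.
  have := IH (N - n)%N; rewrite ltn_subrL n0 (leq_trans n0 (ltnW nN)) => /(_ isT (iter n S x)).
  rewrite tail// head// natrB => [IHn|]; last exact: ltnW.
  rewrite [X in _ <= _ + X + _](@big_cat_nat _ _ _ n)//=; last exact: ltnW.
  by have tle := tail_le n nN nL; lra.
have [xB|xB] := pselect (B x).
  apply: (main 1%N) => //; first exact: leq_ltn_trans L0 LN.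
  by rewrite big_nat1 patchE mem_set//= mulr1 lerDr.
have [n /andP[n0 nL] Jn] := HB x xB.
apply: (main n) => //; first exact: leq_ltn_trans LN.
by rewrite (le_trans Jn)// lerDl sumr_ge0.
Qed.

(** Integrated form of [greedy_bound]; by invariance every time contributes the same integral, and
    the tail has at most [L] of them. *)
Lemma mean_sub_greedy (c : R) (L : nat) (B : set X) : 0 <= c -> (0 < L)%N ->
  measurable B ->
  (forall x, ~ B x -> exists2 n, (0 < n <= L)%N & J n x <= c * n%:R) ->
  forall N, mean_sub N <= c * N%:R +
    N%:R * fine (\int[P]_(x in B) (J 1 x)%:E)%E + L%:R * mean_sub 1.
Proof.
move=> c0 L0 mB HB N; rewrite -lee_fin -mean_subE.
have mJB : measurable_fun setT (J 1 \_ B).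
  by apply/(measurable_restrictT _ mB); exact: measurable_funTS.
have JB0 y : 0 <= (J 1 \_ B) y by rewrite patchE; case: ifPn.
have JBE : (\int[P]_(x in B) (J 1 x)%:E = \int[P]_x ((J 1 \_ B) x)%:E)%E.
  by rewrite integral_mkcond; apply: eq_integral => x _; rewrite !patchE; case: ifP.
have JBfin : (\int[P]_(x in B) (J 1 x)%:E)%E \is a fin_num.
  by apply: integrable_fin_num => //; exact: integrableS J1_int.
have msum (f : X -> R) a b : measurable_fun setT f ->
    measurable_fun setT (fun x => \sum_(a <= t < b) f (iter t S x)).
  move=> mf; apply: measurable_sum => t.
  by apply: measurableT_comp => //; exact: (measurable_iter Smp).
apply: (@le_trans _ _ (\int[P]_x ((c * N%:R)%:E +
    (\sum_(0 <= t < N) (J 1 \_ B) (iter t S x))%:E +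
    (\sum_(N - L <= t < N) J 1 (iter t S x))%:E))%E).
  apply: ge0_le_integral => //.
  - by move=> x _; rewrite lee_fin.
  - exact/measurable_EFinP.
  - apply/measurable_EFinP; apply: measurable_funD; last exact: msum.
    by apply: measurable_funD => //; exact: msum.
  - by move=> x _; rewrite lee_fin; exact: greedy_bound.
have sum0 (f : X -> R) (r : seq nat) x : (forall y, 0 <= f y) ->
    (0 <= (\sum_(t <- r) f (iter t S x))%:E)%E.
  by move=> f0; rewrite lee_fin sumr_ge0.
rewrite ge0_integralD//=; last 4 first.
- by move=> x _; rewrite adde_ge0 ?sum0// lee_fin mulr_ge0.
- by apply/measurable_EFinP; apply: measurable_funD => //; exact: msum.
- by move=> x _; exact: sum0.
- by apply/measurable_EFinP; exact: msum.
rewrite ge0_integralD//=; last 3 first.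
- by move=> x _; rewrite lee_fin mulr_ge0.
- by move=> x _; exact: sum0.
- by apply/measurable_EFinP; exact: msum.
have -> : (\int[P]_x (c * N%:R)%:E = (c * N%:R)%:E)%E.
  rewrite (integral_cst P measurableT) -[RHS]mule1; congr (_ * _)%E.
  exact: probability_setT.
rewrite !integral_orbit_sum// -JBE -(fineK JBfin) mean_subE.
rewrite !size_iota subn0 -!EFinM -!EFinD lee_fin lerD2l.
by rewrite ler_wpM2r ?mean_sub_ge0// ler_nat leq_subLR; lia.
Qed.

(** The points at which [J] admits no lower bound of slope [c] up to an additive constant. *)
Let Lc (c : R) := [set x | forall K : nat, exists n, J n x + K%:R <= c * n%:R].

Let measurable_Lc c : measurable (Lc c).
Proof.
rewrite (_ : Lc c = \bigcap_K \bigcup_n [set x | J n x + K%:R <= c * n%:R]); last first.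
  apply/seteqP; split => x; first by move=> h K _; have [n hn] := h K; exists n.
  by move=> h K; have [n _ hn] := h K I; exists n.
apply: bigcapT_measurable => K; apply: bigcupT_measurable => n.
have := @measurable_fun_ler _ X R setT (fun x => J n x + K%:R) (cst (c * n%:R))
    (measurable_funD (mJ n) (measurable_cst _)) (measurable_cst _) measurableT [set true] I.
by rewrite setTI; congr measurable; apply/seteqP; split => x /=.
Qed.

(** Prefixing one step changes the two sides by at most [|J 1 x|] and [|c|], which a larger
    threshold absorbs. Subadditivity yields this one inclusion, hence the use of
    [ergodic_sub_invariant]. *)
Let Lc_sub c : S @^-1` (Lc c) `<=` Lc c.
Proof.
move=> x /= h K; have [n hn] := h (K + Num.trunc `|J 1 x| + Num.trunc `|c|).+2.
exists n.+1; have := J_sub 1 n x; rewrite add1n => Jn.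
have j1 := truncnS_gt `|J 1 x|; have c1 := truncnS_gt `|c|.
have j2 := ler_norm (J 1 x); have := ler_norm (- c); rewrite normrN => c2.
move: hn; rewrite -addn2 !natrD -[n.+1%:R]natr1 => hn.
move: j1 c1; rewrite -!natr1 => j1 c1; lra.
Qed.

(** If [Lc c] is conull, almost every point starts some block of cost at most [c] per step. The
    points [B L] without such a block of length at most [L] then decrease to a null set, [J 1] has
    small integral over them for large [L], and [mean_sub_greedy] applies. *)
Lemma mean_sub_le_visits (c : R) : 0 <= c -> P (~` Lc c) = 0%E ->
  forall e, 0 < e -> exists K, forall N, mean_sub N <= (c + e) * N%:R + K.
Proof.
move=> c0 PL e e0.
pose B L := [set x | forall n, (0 < n <= L)%N -> c * n%:R < J n x].
have mB L : measurable (B L).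
  rewrite (_ : B L = \bigcap_(n in [set n | (0 < n <= L)%N]) [set x | c * n%:R < J n x]) //.
  have mn n : measurable [set x | c * n%:R < J n x].
    have := @measurable_fun_ltr _ X R setT (cst (c * n%:R)) (J n)
      (measurable_cst _) (mJ n) measurableT [set true] I.
    by rewrite setTI; congr measurable; apply/seteqP; split => x /=.
  rewrite bigcap_mkcond; apply: bigcapT_measurable => n.
  by case: ifP => _; [exact: mn|exact: measurableT].
have BE L x : ~ B L x -> exists2 n, (0 < n <= L)%N & J n x <= c * n%:R.
  move=> nB; apply: contrapT => h; apply: nB => n nL.
  by rewrite ltNge; apply/negP => Jn; apply: h; exists n.
have [L hL] : exists L, fine (\int[P]_(x in B L.+1) (J 1 x)%:E)%E <= e.
  have J1m : measurable_fun setT (EFin \o J 1) by exact/measurable_EFinP.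
  have abs1 x : `|(EFin \o J 1) x|%E = (EFin \o J 1) x by rewrite /= ger0_norm.
  have [|||||_ _] := @dominated_convergence _ X R P setT measurableT
    (fun L => (EFin \o J 1) \_ (B L)) (cst 0%E) (EFin \o J 1).
  - by move=> n; apply/(measurable_restrictT _ (mB n)); exact: measurable_funTS.
  - exact: measurable_cst.
  - exists (~` Lc c); split => //; first exact: measurableC.
    move=> x /= h Lx; apply: h => _; apply: cvg_near_cst.
    (* Threshold 1 rather than 0 rules out [n = 0], where [J] vanishes. *)
    have [n hn] := Lx 1%N; exists n => // k /= nk; rewrite patchE memNset// => Bx.
    case: n hn nk => [|n] hn nk; first by move: hn; rewrite J0; lra.
    by have := Bx n.+1 nk; lra.
  - exact: J1_int.
  - apply: aeW => x n _; rewrite patchE; case: ifPn => [_|_]; first by rewrite abs1.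
    by rewrite abse0 /= lee_fin.
  rewrite integral0 => /fine_cvgP[_] /cvgr0Pnorm_le => /(_ e e0)[L _ hL].
  exists L; have := hL L.+1 (leqnSn L); rewrite /= -integral_mkcond.
  exact: le_trans (ler_norm _).
exists (L.+1%:R * mean_sub 1) => N.
have := mean_sub_greedy c0 (ltn0Sn L) (mB _) (BE _) N.
have N0 : (0 : R) <= N%:R by [].
by have := ler_wpM2l N0 hL; lra.
Qed.

(** The upper bound comes from the pointwise theory: for [c] above [rate], [subadditive_le_rate]
    with a slope strictly in between makes [Lc c] conull, and [mean_sub_le_visits] bounds the
    means. *)
Lemma mean_sub_rate_cvg : mean_sub n / n%:R @[n --> \oo] --> rate.
Proof.
have lo n : rate <= mean_sub n.+1 / n.+1%:R := rate_le n.
have hi c : rate < c -> forall e, 0 < e ->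
    exists K, forall N, mean_sub N <= (c + e) * N%:R + K.
  move=> rc; apply: mean_sub_le_visits; first exact: le_trans rate_ge0 (ltW rc).
  have rc' : rate < (rate + c) / 2 by lra.
  have /negligibleP <- : measurable (~` Lc c) by exact: measurableC.
  apply: negligibleS (subadditive_le_rate rc') => x; apply: contra_not => -[K hK] k.
  have rc2 : 0 < (c - rate) / 2 by lra.
  have [n hn] : exists n : nat, k%:R + K <= (c - rate) / 2 * n%:R.
    exists (Num.trunc (`|k%:R + K| / ((c - rate) / 2))).+1.
    rewrite -ler_pdivrMl// mulrC (le_trans _ (ltW (truncnS_gt _)))//.
    by rewrite ler_pM2r ?invr_gt0// ler_norm.
  by exists n; have := hK n; lra.
apply/cvgrPdist_le => e e0.
have re : rate < rate + e / 3 by lra.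
have e3 : 0 < e / 3 by lra.
have [K hK] := hi _ re _ e3.
exists (Num.trunc (`|K| / (e / 3))).+1 => // n /= hn.
have n0 : 0 < n%:R :> R by rewrite ltr0n; apply: leq_trans hn.
have Kn : K <= e / 3 * n%:R.
  rewrite -ler_pdivrMl// mulrC; apply: (@le_trans _ _ (`|K| / (e / 3))).
    by rewrite ler_pM2r ?invr_gt0// ler_norm.
  by rewrite (le_trans (ltW (truncnS_gt _)))// ler_nat.
case: n hn n0 Kn => // n _ n0 Kn.
have lon := lo n; have hKn := hK n.+1.
rewrite ler0_norm ?subr_le0// opprB lerBlDr ler_pdivrMr//; lra.
Qed.

(** Only the lower bound is left. If it failed for a slope [c < rate] on a set of positive measure,
    [Lc c] would be conull by ergodicity, and the means would drop below [rate]. *)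
Theorem subadditive_cvg :
  {ae P, forall x, J n x / n%:R @[n --> \oo] --> rate}.
Proof.
have lower c : c < rate -> {ae P, forall x, exists K : R, forall n, c * n%:R <= J n x + K}.
  move=> cr; have [c0|c0] := ltP c 0.
    apply: aeW => x; exists 0 => n; rewrite addr0 (le_trans _ (J_ge0 n x))//.
    by rewrite mulr_le0_ge0// ltW.
  have [PL|PL] := ergodic_sub_invariant (measurable_Lc c) (@Lc_sub c).
    exists (Lc c); split => // x; apply: contra_notP => h.
    have [K hK] : exists K : nat, forall n, c * n%:R < J n x + K%:R.
      apply: contrapT => nK; apply: h => K; apply: contrapT => nn; apply: nK.
      exists K => n; rewrite ltNge; apply/negP => Jn; apply: nn; exists n; exact: Jn.
    by exists K%:R => n; exact: ltW.
  (* One third separates [c] from the slope [c + e], one absorbs the constant [K] at a large length,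
     and the last leaves a mean of at most [rate - e]. *)
  exfalso; pose e := (rate - c) / 3.
  have e0 : 0 < e by rewrite /e; lra.
  have [K hK] := mean_sub_le_visits c0 PL e0.
  pose n := Num.trunc (`|K| / e).
  have Kn : K <= e * n.+1%:R.
    rewrite -ler_pdivrMl// mulrC; apply: (@le_trans _ _ (`|K| / e)).
      by rewrite ler_pM2r ?invr_gt0// ler_norm.
    exact/ltW/truncnS_gt.
  have := rate_le n; rewrite ler_pdivlMr// => rn; have hKn := hK n.+1.
  have n0 : 0 < n.+1%:R :> R by [].
  have : rate * n.+1%:R <= (rate - e) * n.+1%:R by rewrite /e in Kn hKn *; lra.
  by rewrite ler_pM2r//; lra.
have H1 : {ae P, forall x, forall j : nat, exists K : R, forall n,
    J n x <= (rate + j.+1%:R^-1) * n%:R + K}.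
  by apply: ae_foralln => j; apply: subadditive_le_rate; rewrite ltrDl invr_gt0.
have H2 : {ae P, forall x, forall j : nat, exists K : R, forall n,
    (rate - j.+1%:R^-1) * n%:R <= J n x + K}.
  by apply: ae_foralln => j; apply: lower; rewrite ltrBlDr ltrDl invr_gt0.
apply: filterS2 H1 H2 => x K1 K2; apply/cvgrPdist_le => e e0.
have [j je] : exists j : nat, j.+1%:R^-1 <= e / 2.
  exists (Num.trunc (2 / e)); rewrite invf_ple ?posrE ?divr_gt0//.
  by rewrite invf_div; apply/ltW/truncnS_gt.
have [k1 hk1] := K1 j; have [k2 hk2] := K2 j.
have e2 : 0 < e / 2 by lra.
exists (Num.trunc ((`|k1| + `|k2|) / (e / 2))).+1 => // n /= hn.
have n0 : 0 < n%:R :> R by rewrite ltr0n; apply: leq_trans hn.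
have Kn : `|k1| + `|k2| <= e / 2 * n%:R.
  rewrite -ler_pdivrMl// mulrC.
  by rewrite (le_trans (ltW (truncnS_gt _)))// ler_nat.
have h1 := hk1 n; have h2 := hk2 n; have a1 := ler_norm k1; have a2 := ler_norm k2.
have a3 := normr_ge0 k1; have a4 := normr_ge0 k2.
have jn : j.+1%:R^-1 * n%:R <= e / 2 * n%:R by rewrite ler_pM2r.
move: h1 h2 jn; move: (j.+1%:R^-1) => i h1 h2 jn.
have -> : rate - J n x / n%:R = (rate * n%:R - J n x) / n%:R.
  by rewrite mulrBl mulfK ?gt_eqF.
by rewrite ler_norml ler_pdivlMr// ler_pdivrMr//; apply/andP; split; lra.
Qed.

End subadditive_ergodic.

(** * Countable-valued labels *)

Section countable_fibers.
Context {d : measure_display} {X : measurableType d} {R : realType}.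
Context {K : countType} {N : X -> K}.
Hypothesis mN : forall k, measurable (N @^-1` [set k]).

Lemma measurable_preimage_countable (Y : set K) : measurable (N @^-1` Y).
Proof.
pose F i := if pickle_inv i is Some k then
  if k \in Y then N @^-1` [set k] else set0 else set0.
rewrite (_ : _ @^-1` _ = \bigcup_i F i).
  by apply: bigcupT_measurable => i; rewrite /F; case: pickle_inv => // k; case: ifP.
apply/seteqP; split => x /=.
  by move=> Yx; exists (pickle (N x)) => //; rewrite /F pickleK_inv mem_set.
by move=> [i _]; rewrite /F; case: pickle_inv => // k; case: ifPn => // /set_mem Yk /= ->.
Qed.

Lemma measurable_countable_comp {d'} {Y : measurableType d'} (f : K -> Y) :
  measurable_fun setT (f \o N).
Proof.
by move=> _ B mB; rewrite setTI comp_preimage; exact: measurable_preimage_countable.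
Qed.

(** Fibers are numbered through [pickle] to use countable additivity over [nat]; numbers that code
    no label have empty fibers. *)
Lemma ge0_integral_fibers (mu : {measure set X -> \bar R}) (f : X -> \bar R) :
  measurable_fun setT f -> (forall x, 0 <= f x)%E ->
  (\int[mu]_x f x = \esum_(k in [set: K]) \int[mu]_(x in N @^-1` [set k]) f x)%E.
Proof.
move=> mf f0; pose F (i : nat) := (fun x => pickle (N x)) @^-1` [set i].
have mF i : measurable (F i).
  by apply: (measurable_preimage_countable [set k | pickle k = i]).
have FT : \bigcup_i F i = setT by apply/seteqP; split => // x _; exists (pickle (N x)).
rewrite -{1}FT ge0_integral_bigcup//; last 2 first.
- by rewrite FT.
- by move=> i j _ _ [x [/= <- <-]].
rewrite nneseries_esumT; last by move=> i; apply: integral_ge0.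
rewrite (esumID (range (pickle : K -> nat)))/=; last first.
  by move=> i _; apply: integral_ge0.
rewrite [X in (_ + X)%E]esum1 ?adde0; last first.
  move=> i [_ Ni]; rewrite (_ : F i = set0) ?integral_set0//.
  by apply/seteqP; split => // x /= xi; apply: Ni; exists (N x).
rewrite setTI esum_image; last by move=> i j _ _ /(pcan_inj pickleK).
apply: eq_esum => k _; congr integral; apply/seteqP; split => x /=.
  exact: (pcan_inj pickleK).
exact: congr1.
Qed.

Lemma ge0_integral_countable_comp (mu : {measure set X -> \bar R}) (f : K -> \bar R) :
  (forall k, 0 <= f k)%E ->
  (\int[mu]_x f (N x) = \esum_(k in [set: K]) f k * mu (N @^-1` [set k]))%E.
Proof.
move=> f0; rewrite ge0_integral_fibers//; last exact: measurable_countable_comp.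
apply: eq_esum => k _.
rewrite (eq_integral (cst (f k))); last by move=> x /set_mem /= ->.
rewrite integral_cst//.
Qed.

(** An inequality only, because labels of measure 0 drop out of the left side. It bounds the density
    terms in the Gibbs-type comparisons. *)
Lemma integral_density_le (mu : {measure set X -> \bar R}) (g : K -> R) :
  (forall k, 0 <= g k) -> (forall k, mu (N @^-1` [set k]) < +oo)%E ->
  (\int[mu]_x (g (N x) / fine (mu (N @^-1` [set N x])))%:E <=
   \esum_(k in [set: K]) (g k)%:E)%E.
Proof.
move=> g0 muoo; have fmu k : mu (N @^-1` [set k]) \is a fin_num.
  by rewrite ge0_fin_numE.
rewrite (@ge0_integral_countable_comp mu
  (fun k => (g k / fine (mu (N @^-1` [set k])))%:E)); last first.
  by move=> k; rewrite lee_fin divr_ge0// fine_ge0.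
apply: le_esum => k _; rewrite -[X in (_ * X)%E](fineK (fmu k)) -EFinM lee_fin.
have [->|h] := eqVneq (fine (mu (N @^-1` [set k]))) 0; first by rewrite mulr0.
by rewrite divfK.
Qed.

End countable_fibers.

(** Induction step for bounding the partial sums of [1 / n ^ 2] by [2 - 1 / n]. *)
Lemma telescope_inv_sq {R : realFieldType} (a : R) : 0 < a ->
  2 - a^-1 + ((a + 1) ^+ 2)^-1 <= 2 - (a + 1)^-1.
Proof.
move=> a0; rewrite -subr_ge0 (_ : _ - _ = (a * (a + 1) ^+ 2)^-1); last by field; lra.
by rewrite invr_ge0 mulr_ge0 ?sqr_ge0// ltW.
Qed.

(** * Borel-Cantelli comparison of weights with measures of fibers *)

Section borel_cantelli_density.
Context {d : measure_display} {X : measurableType d} {R : realType}.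
Context (mu : {measure set X -> \bar R}) {K : countType} (N : nat -> X -> K).
Hypothesis mN : forall n k, measurable (N n @^-1` [set k]).

(** The fibers where [g n] exceeds [n ^ 2] times their measure have total measure at most
    [1 / n ^ 2], as [g n] has mass at most 1; this is summable. The measure is finite rather than a
    probability because [m] restricted to a level set of the return time is one use. *)
Lemma ae_weight_le_density (g : nat -> K -> R) :
  (forall n k, 0 <= g n k) -> (mu setT < +oo)%E ->
  (forall n, \esum_(k in [set: K]) (g n k)%:E <= 1)%E ->
  {ae mu, forall x, \forall n \near \oo,
    g n (N n x) <= n%:R ^+ 2 * fine (mu (N n @^-1` [set N n x]))}.
Proof.
move=> g0 muoo g1.
pose bad n := [set k | n%:R ^+ 2 * fine (mu (N n @^-1` [set k])) < g n k].
pose E n := N n @^-1` (bad n).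
have mE n : measurable (E n) by exact: measurable_preimage_countable.
have muN n k : (mu (N n @^-1` [set k]) < +oo)%E.
  by apply: le_lt_trans muoo; apply: le_measure; rewrite ?inE.
have muE n : (mu (E n.+1) <= ((n.+1%:R ^+ 2)^-1)%:E)%E.
  pose q : R := n.+1%:R ^+ 2; have q0 : 0 < q by rewrite exprn_gt0.
  have : (q%:E * mu (E n.+1) <= 1)%E.
    apply: le_trans (g1 n.+1).
    have -> : (q%:E * mu (E n.+1) = \int[mu]_x (q * \1_(bad n.+1) (N n.+1 x))%:E)%E.
      under eq_integral do rewrite EFinM.
      have mI : measurable_fun setT (fun x => (\1_(bad n.+1) (N n.+1 x))%:E : \bar R).
        exact: (measurable_countable_comp (mN n.+1) (fun k => (\1_(bad n.+1) k)%:E)).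
      rewrite ge0_integralZl_EFin ?ltW//.
      rewrite (eq_integral (fun x => (\1_(E n.+1) x)%:E))// integral_indic//.
      by rewrite setIT.
    rewrite (@ge0_integral_countable_comp _ _ _ _ _ (mN n.+1) mu
      (fun k => (q * \1_(bad n.+1) k)%:E)); last first.
      by move=> k; rewrite lee_fin mulr_ge0// ltW.
    apply: le_esum => k _; rewrite indicE; case: (boolP (k \in _)) => [/set_mem /= bk|_].
      rewrite mulr1 -[X in (_ * X)%E]fineK ?ge0_fin_numE// -EFinM lee_fin.
      exact: ltW.
    by rewrite mulr0 mul0e lee_fin.
  by rewrite -lee_pdivlMl// mule1.
have muE0 : mu (lim_sup_set E) = 0%E.
  apply: lim_sup_set_cvg0 => //.
  have muT : mu setT \is a fin_num by rewrite ge0_fin_numE.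
  (* At index 0 the factor [n ^ 2] vanishes and gives no bound, so that term is charged to the total
     mass. *)
  have S n : (\sum_(0 <= i < n.+2) mu (E i) <= mu setT + (2 - n.+1%:R^-1)%:E)%E.
    have E0 : (mu (E 0%N) <= mu setT)%E by apply: le_measure; rewrite ?inE.
    elim: n => [|n IH].
      rewrite big_nat_recr//= big_nat1 leeD// (le_trans (muE 0%N))// lee_fin.
      by rewrite expr1n invr1; lra.
    rewrite big_nat_recr//= (le_trans (leeD IH (muE n.+1)))// -addeA leeD2l//.
    rewrite -EFinD lee_fin.
    have a0 : 0 < n.+1%:R :> R by [].
    have -> : n.+2%:R = n.+1%:R + 1 :> R by rewrite natr1.
    exact: telescope_inv_sq.
  apply: (@le_lt_trans _ _ (mu setT + 2%:E)%E); last by rewrite lte_add_pinfty ?ltry.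
  apply: lime_le; first exact: is_cvg_nneseries.
  exists 2%N => // -[|[|n]]//= _.
  by rewrite (le_trans (S n))// leeD2l// lee_fin lerBlDr lerDl invr_ge0.
exists (lim_sup_set E); split => //.
  apply: bigcapT_measurable => n; exact: bigcup_measurable.
move=> x; apply: contra_notP => h.
have [n hn] : exists n, forall k, (n <= k)%N -> ~ E k x.
  apply: contrapT => h'; apply: h => n _; apply: contrapT => hn; apply: h'.
  by exists n => k nk Ek; apply: hn; exists k.
by exists n => // k /= nk; rewrite leNgt; apply/negP; exact: hn.
Qed.

End borel_cantelli_density.

Lemma esumZl_le {R : realType} {K : choiceType} (I : set K) (c : R) (b : K -> \bar R) :
  0 <= c -> (forall i, 0 <= b i)%E ->
  (\esum_(i in I) (c%:E * b i) <= c%:E * \esum_(i in I) b i)%E.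
Proof.
move=> c0 b0; apply: ge_ereal_sup => _ [Y [finY YI] <-].
rewrite -ge0_mule_fsumr// lee_wpmul2l ?lee_fin//.
by apply: ereal_sup_ubound; exists Y.
Qed.

(** Cutting at [l] identifies words of length [l + n] with pairs of words of lengths [l] and [n], so
    the double sum factors. *)
Lemma esum_cat_le {R : realType} {K : countType} (f g : seq K -> R) (l n : nat) :
  (forall s, 0 <= f s) -> (forall s, 0 <= g s) ->
  (\esum_(s in [set s | size s = l]) (f s)%:E <= 1)%E ->
  (\esum_(s in [set s | size s = n]) (g s)%:E <= 1)%E ->
  (\esum_(s in [set s | size s = (l + n)%N]) (f (take l s) * g (drop l s))%:E <= 1)%E.
Proof.
move=> f0 g0 f1 g1.
rewrite (reindex_esum ([set s | size s = l] `*`` (fun=> [set s | size s = n]))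
   [set s : seq K | size s = (l + n)%N] (fun p => p.1 ++ p.2)); last first.
  split.
  - by move=> [s t] [/= sl tn]; rewrite size_cat sl tn.
  - move=> [s t] [s' t']; rewrite !inE /= => -[/= sl tn] [/= sl' tn'] /eqP.
    by rewrite eqseq_cat ?sl ?sl'// => /andP[/eqP -> /eqP ->].
  - move=> s /= sln; exists (take l s, drop l s) => /=; last exact: cat_take_drop.
    by split=> /=; [rewrite size_takel// sln leq_addr|rewrite size_drop sln addKn].
rewrite (eq_esum (b := fun p : seq K * seq K => (f p.1 * g p.2)%:E)); last first.
  by move=> [s t] [/= sl tn]; rewrite take_size_cat// drop_size_cat.
rewrite -(@esum_esum _ _ _ _ _ (fun s t => (f s * g t)%:E)); last first.
  by move=> s t _ _; rewrite lee_fin mulr_ge0.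
apply: le_trans f1; apply: le_esum => s _.
rewrite (eq_esum (b := fun t => ((f s)%:E * (g t)%:E)%E)); last by move=> t _; rewrite EFinM.
apply: (le_trans (esumZl_le _ (f0 s) _)); first by move=> t; rewrite lee_fin.
by rewrite -[leRHS]mule1 lee_wpmul2l// lee_fin.
Qed.

(** * A supermultiplicative subprobability on words *)

Section block_code.
Context {K : countType} {R : realType}.
Variable q : seq K -> R.

(** These weights telescope to a sum below 1, yet [- ln] of them grows only like [2 ln l]. *)
Definition block_weight (l : nat) : R := (l%:R * l.+1%:R)^-1.

(** Recursion through [drop l s] is not structural, hence the fuel; the length of the word suffices
    since every block has a letter. *)
Fixpoint block_code_fuel (k : nat) (s : seq K) : R :=
  if k is k'.+1 then
    if s is [::] then 1 else
    \sum_(1 <= l < (size s).+1)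
      block_weight l * (q (take l s) * block_code_fuel k' (drop l s))
  else (nilp s)%:R.

(* The total weight of all parsings of s into blocks, a block b contributing
   [block_weight (size b) * q b]. *)
Definition block_code (s : seq K) : R := block_code_fuel (size s) s.

Lemma block_code_fuelE k s : (size s <= k)%N -> block_code_fuel k s = block_code s.
Proof.
move=> sk; rewrite /block_code.
suff H : forall k j s, (size s <= k)%N -> (size s <= j)%N ->
    block_code_fuel k s = block_code_fuel j s.
  exact: H.
elim=> [|{sk}k IH] [|j] [|i {}s] //= sk sj; rewrite ltnS in sj; rewrite ltnS in sk.
rewrite big_nat [RHS]big_nat; apply: eq_bigr => -[//|l] /= _; congr (_ * (_ * _)).
have sd : (size (drop l s) <= size s)%N by rewrite size_drop leq_subr.
by apply: IH; apply: leq_trans sd _.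
Qed.

Lemma block_code_nil : block_code [::] = 1. Proof. by []. Qed.

Lemma block_codeE s : s != [::] -> block_code s = \sum_(1 <= l < (size s).+1)
  block_weight l * (q (take l s) * block_code (drop l s)).
Proof.
case: s => [//|i s] _; rewrite /block_code /= big_nat [RHS]big_nat.
apply: eq_bigr => -[//|l] /= _; rewrite block_code_fuelE// size_drop leq_subr//.
Qed.

Lemma block_weight_ge0 l : 0 <= block_weight l.
Proof. by rewrite invr_ge0 mulr_ge0. Qed.

Lemma block_weight_gt0 l : (0 < l)%N -> 0 < block_weight l.
Proof. by move=> l0; rewrite invr_gt0 mulr_gt0// ltr0n. Qed.

Lemma sum_block_weight n : \sum_(1 <= l < n.+1) block_weight l = 1 - n.+1%:R^-1.
Proof.
elim: n => [|n IH]; first by rewrite big_geq// invr1 subrr.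
rewrite big_nat_recr//= IH /block_weight.
have -> : n.+2%:R = n.+1%:R + 1 :> R by rewrite natr1.
have : 0 < n.+1%:R :> R by []; move: (n.+1%:R) => x x0.
by field; apply/andP; split; lra.
Qed.

Hypothesis q_ge0 : forall s, 0 <= q s.
Hypothesis q_le1 : forall s, q s <= 1.

Lemma block_code_ge0 s : 0 <= block_code s.
Proof.
rewrite /block_code; move: (size s) => k; elim: k s => [|k IH] s /=; first by [].
case: s => [//|i s]; apply: sumr_ge0 => l _.
by rewrite !mulr_ge0 ?block_weight_ge0.
Qed.

Lemma block_code_le1 s : block_code s <= 1.
Proof.
have [n] := ubnP (size s); elim: n s => // n IH s; rewrite ltnS => sn.
have [->|s0] := eqVneq s [::]; first by rewrite block_code_nil.
rewrite block_codeE// (@le_trans _ _ (\sum_(1 <= l < (size s).+1) block_weight l))//.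
  rewrite big_nat [leRHS]big_nat; apply: ler_sum => l /andP[l1 ls].
  rewrite -[leRHS]mulr1 ler_wpM2l ?block_weight_ge0// mulr_ile1 ?block_code_ge0//.
  apply: IH; rewrite size_drop.
  have : (0 < size s)%N by rewrite lt0n size_eq0.
  by move: l1 ls sn; lia.
by rewrite sum_block_weight gerBl.
Qed.

Lemma block_code_single s : (0 < size s)%N -> block_weight (size s) * q s <= block_code s.
Proof.
move=> s0; rewrite block_codeE; last by case: (s) s0.
rewrite big_nat_recr//= take_size drop_size block_code_nil mulr1 lerDr sumr_ge0// => l _.
by rewrite !mulr_ge0 ?block_weight_ge0 ?block_code_ge0.
Qed.

(** A parsing of [s] followed by one of [t] is a parsing of [s ++ t], with the product of the
    weights. The induction strips the first block of [s]. *)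
Lemma block_code_cat s t : block_code s * block_code t <= block_code (s ++ t).
Proof.
have [n] := ubnP (size s); elim: n s => // n IH s; rewrite ltnS => sn.
have [->|s0] := eqVneq s [::]; first by rewrite block_code_nil mul1r.
rewrite (block_codeE s0) [leRHS]block_codeE; last by rewrite -size_eq0 size_cat addn_eq0 size_eq0 (negbTE s0).
rewrite [leRHS](@big_cat_nat _ _ _ (size s).+1)//=; last by rewrite ltnS size_cat leq_addr.
rewrite -[leLHS]addr0 lerD//; last first.
  by apply: sumr_ge0 => l _; rewrite !mulr_ge0 ?block_weight_ge0 ?block_code_ge0.
rewrite mulr_suml [leLHS]big_nat [leRHS]big_nat; apply: ler_sum => l /andP[l1 ls].
rewrite -!mulrA ler_wpM2l ?block_weight_ge0//.
rewrite takel_cat// (_ : drop l (s ++ t) = drop l s ++ t); last first.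
  move: ls; rewrite ltnS leq_eqVlt => /orP[/eqP ->|ls].
    by rewrite drop_size drop_size_cat.
  by rewrite drop_cat ls.
rewrite ler_wpM2l//; apply: IH; rewrite size_drop.
have : (0 < size s)%N by rewrite lt0n size_eq0.
by move: l1 ls sn; lia.
Qed.

Hypothesis q_mass : forall n, (\esum_(s in [set s | size s = n]) (q s)%:E <= 1)%E.

(** Sort parsings by the length [l] of the first block: that block and the rest each have mass at
    most 1, so the total is at most the sum of the weights. *)
Lemma esum_block_code_le1 n :
  (\esum_(s in [set s | size s = n]) (block_code s)%:E <= 1)%E.
Proof.
elim/ltn_ind: n => n IH; case: n IH => [|n] IH.
  rewrite (_ : [set _ | _] = [set [::]]); last first.
    by apply/seteqP; split => [[]|_ ->].
  by rewrite esum_set1 ?lee_fin ?block_code_ge0// block_code_nil.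
rewrite (eq_esum (b := fun s => (\sum_(1 <= l < n.+2)
    (block_weight l * (q (take l s) * block_code (drop l s)))%:E)%E)); last first.
  by move=> s /= sn; rewrite block_codeE; [rewrite sn sumEFin|case: (s) sn].
rewrite esum_sum; last first.
  by move=> s l _ _; rewrite lee_fin !mulr_ge0 ?block_weight_ge0 ?block_code_ge0.
apply: (@le_trans _ _ (\sum_(1 <= l < n.+2) (block_weight l)%:E)%E); last first.
  by rewrite sumEFin sum_block_weight lee_fin gerBl.
rewrite big_nat [leRHS]big_nat; apply: lee_sum => l /andP[l1 ln].
rewrite (eq_esum (b := fun s => ((block_weight l)%:E *
    (q (take l s) * block_code (drop l s))%:E)%E)); last by move=> s _; rewrite EFinM.
apply: (le_trans (esumZl_le _ (block_weight_ge0 l) _)).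
  by move=> s; rewrite lee_fin mulr_ge0 ?block_code_ge0.
rewrite -[leRHS]mule1 lee_wpmul2l ?lee_fin ?block_weight_ge0//.
have -> : n.+1 = (l + (n.+1 - l))%N by rewrite subnKC// -ltnS.
apply: esum_cat_le => //; first exact: block_code_ge0.
by apply: IH; rewrite ltn_subrL l1.
Qed.

End block_code.

(** * Shannon-McMillan-Breiman theorem *)

Section sublinear.
Context {R : realType}.

Lemma ln_nat_div_cvg0 : ln n%:R / n%:R @[n --> \oo] --> (0 : R).
Proof.
apply/cvgr0Pnorm_le => e e0.
have e2 : 0 < e / 2 by lra.
exists (Num.trunc (`|ln (e / 2)| / (e / 2))).+1 => // n /= hn.
have n1 : (0 < n)%N by apply: leq_trans hn.
have n0 : 0 < n%:R :> R by rewrite ltr0n.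
rewrite ger0_norm ?divr_ge0 ?ln_ge0 ?ler1n//.
have : ln (n%:R * (e / 2)) < n%:R * (e / 2) by apply: ln_sublinear; rewrite mulr_gt0.
rewrite lnM ?posrE// => h.
have : `|ln (e / 2)| <= n%:R * (e / 2).
  rewrite -ler_pdivrMr// (le_trans (ltW (truncnS_gt _)))// ler_nat//.
have h2 := ler_norm (- ln (e / 2)); rewrite normrN in h2.
by move=> h1; rewrite ler_pdivrMr//; lra.
Qed.

Lemma cvg_div_close (u v r : nat -> R) (h : R) :
  v n / n%:R @[n --> \oo] --> h -> r n / n%:R @[n --> \oo] --> 0 ->
  (\forall n \near \oo, `|u n - v n| <= r n) ->
  u n / n%:R @[n --> \oo] --> h.
Proof.
move=> vh r0 uv.
have -> : (fun n => u n / n%:R) = (fun n => v n / n%:R + (u n - v n) / n%:R).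
  by apply/funext => n; rewrite -mulrDl addrC subrK.
rewrite -[h]addr0; apply: cvgD => //.
have Nr0 : - (r n / n%:R) @[n --> \oo] --> (0 : R) by rewrite -[0]oppr0; exact: cvgN.
apply: squeeze_cvgr Nr0 r0; apply: filterS uv => n; rewrite ler_norml => /andP[h1 h2].
by rewrite -mulNr !ler_wpM2r ?invr_ge0.
Qed.

End sublinear.

Section shannon_mcmillan_breiman.
Context {d : measure_display} {X : measurableType d} {R : realType}.
Context {P : probability X R} {S : X -> X}.
Hypothesis Smp : measure_preserving P S.
Hypothesis Serg : ergodic P S.
Context {K : countType}.
Variable a : X -> K.
Hypothesis ma : forall i, measurable (a @^-1` [set i]).

Definition word (n : nat) (x : X) : seq K := [seq a (iter t S x) | t <- iota 0 n].

Arguments word : simpl never.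

Lemma size_word n x : size (word n x) = n.
Proof. by rewrite size_map size_iota. Qed.

Lemma wordD m n x : word (m + n) x = word m x ++ word n (iter m S x).
Proof.
rewrite /word iotaD map_cat add0n; congr (_ ++ _).
rewrite -{1}[m]addn0 iotaDl -map_comp; apply: eq_map => t /=.
by rewrite addnC iterD.
Qed.

Lemma wordS n x : word n.+1 x = a x :: word n (S x).
Proof. by rewrite -add1n wordD. Qed.

Lemma word_eqP n x y :
  word n x = word n y <-> forall t, (t < n)%N -> a (iter t S x) = a (iter t S y).
Proof.
split=> [/eq_in_map h t tn|h]; first by apply: h; rewrite mem_iota.
by apply/eq_in_map => t; rewrite mem_iota => /= tn; exact: h.
Qed.

Lemma measurable_word n s : measurable (word n @^-1` [set s]).
Proof.
elim: n s => [|n IH] s.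
  rewrite (_ : _ @^-1` _ = if s == [::] then setT else set0); first by case: ifP.
  by case: eqVneq => [->|s0]; apply/seteqP; split => // x /= h; move: s0; rewrite -h.
case: s => [|i s].
  by rewrite (_ : _ @^-1` _ = set0)//; apply/seteqP; split.
rewrite (_ : _ @^-1` _ = a @^-1` [set i] `&` iter 1 S @^-1` (word n @^-1` [set s])).
  apply: measurableI => //; exact: (measurable_preimage_iter Smp).
apply/seteqP; split => x /=; rewrite wordS; first by move=> [-> ->].
by move=> [-> ->].
Qed.

Definition word_prob (s : seq K) : R := fine (P (word (size s) @^-1` [set s])).

Lemma word_probE n x : P (word n @^-1` [set word n x]) = (word_prob (word n x))%:E.
Proof.
rewrite /word_prob size_word fineK// fin_num_measure//; exact: measurable_word.
Qed.

Lemma word_prob_ge0 s : 0 <= word_prob s.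
Proof. exact: fine_ge0. Qed.

Lemma word_prob_le1 s : word_prob s <= 1.
Proof.
rewrite -lee_fin fineK ?fin_num_measure//; last exact: measurable_word.
exact/probability_le1/measurable_word.
Qed.

Lemma word_prob_mass n : (\esum_(s in [set s | size s = n]) (word_prob s)%:E <= 1)%E.
Proof.
have <- : (\int[P]_x (cst 1%E : X -> \bar R) x = 1)%E.
  by rewrite (integral_cst P measurableT 1%E) mul1e; exact: probability_setT.
rewrite (@ge0_integral_countable_comp _ _ _ _ _ (measurable_word n) P (cst 1%E))//.
rewrite esum_mkcond; apply: le_esum => s _; case: ifPn => [/set_mem /= <-|_].
  by rewrite mul1e fineK// fin_num_measure//; exact: measurable_word.
by rewrite mul1e.
Qed.

(** By invariance of [P], the word read after [size s] steps has the same law as the initial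
    word. *)
Lemma word_prob_catr s t : word_prob (s ++ t) <= word_prob t.
Proof.
rewrite fine_le ?fin_num_measure//; try exact: measurable_word.
rewrite -[leRHS](measure_preimage_iter Smp (size s)); last exact: measurable_word.
apply: le_measure; rewrite ?inE; try exact: measurable_word.
  exact/(measurable_preimage_iter Smp)/measurable_word.
move=> x /=; rewrite size_cat wordD => /eqP.
by rewrite eqseq_cat ?size_word// => /andP[_ /eqP].
Qed.

Definition word_info n x : R := - ln (word_prob (word n x)).

Lemma word_info_ge0 n x : 0 <= word_info n x.
Proof. by rewrite oppr_ge0 ln_le0// word_prob_le1. Qed.

Lemma measurable_word_info n : measurable_fun setT (word_info n).
Proof. exact: (measurable_countable_comp (measurable_word n) (fun s => - ln (word_prob s))). Qed.

Let good := [set x | forall n, 0 < word_prob (word n x)].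

Let good_shift x : good x -> good (S x).
Proof.
move=> gx n; apply: lt_le_trans (gx n.+1) _.
by rewrite wordS -cat1s word_prob_catr.
Qed.

Let good_iter n x : good x -> good (iter n S x).
Proof. by elim: n => //= n IH /IH; exact: good_shift. Qed.

Let measurable_good : measurable good.
Proof.
rewrite (_ : good = \bigcap_n (word n @^-1` [set s | 0 < word_prob s])); last first.
  by apply/seteqP; split => x; [move=> h n _; exact: h|move=> h n; exact: h].
apply: bigcapT_measurable => n; exact/measurable_preimage_countable/measurable_word.
Qed.

Lemma word_prob_gt0_ae : {ae P, forall x, forall n, 0 < word_prob (word n x)}.
Proof.
apply: ae_foralln => n; pose N := word n @^-1` [set s | word_prob s = 0].
exists N; split.
- exact/measurable_preimage_countable/measurable_word.
- transitivity (\int[P]_x (\1_[set s | word_prob s = 0] (word n x) : R)%:E)%E.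
    rewrite (eq_integral (fun x => (\1_N x)%:E))// integral_indic ?setIT//.
    exact/measurable_preimage_countable/measurable_word.
  rewrite (@ge0_integral_countable_comp _ _ _ _ _ (measurable_word n) P
    (fun s => (\1_[set s | word_prob s = 0] s)%:E))//.
  rewrite esum1// => s _; rewrite indicE; case: (boolP (s \in _)) => [/set_mem /= s0|_].
    have [sn|sn] := eqVneq (size s) n.
      rewrite -sn mul1e -[LHS]fineK ?fin_num_measure//; last exact: measurable_word.
      by rewrite -/(word_prob s) s0.
    rewrite (_ : _ @^-1` _ = set0) ?measure0 ?mule0//.
    by apply/seteqP; split => // x /= xs; move: sn; rewrite -xs size_word eqxx.
  by rewrite mul0e.
- by move=> x /= h; apply/eqP; rewrite eq_le word_prob_ge0 andbT leNgt; apply/negP.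
Qed.

Let good_ae : {ae P, forall x, good x}. Proof. exact: word_prob_gt0_ae. Qed.

Let Q := block_code word_prob.

Let Q_gt0 n x : good x -> 0 < Q (word n x).
Proof.
move=> gx; case: n => [|n]; first by rewrite /Q block_code_nil.
apply: lt_le_trans (block_code_single word_prob_ge0 _); last by rewrite size_word.
by rewrite mulr_gt0 ?block_weight_gt0 ?size_word.
Qed.

(** The value 0 off the forward invariant set [good] makes nonnegativity and subadditivity hold at
    every point, as the subadditive theorem requires, and not merely almost everywhere. *)
Let J n x := if x \in good then - ln (Q (word n x)) else 0.

Let J_ge0 n x : 0 <= J n x.
Proof.
rewrite /J; case: ifP => // _; rewrite oppr_ge0 ln_le0//.
exact: block_code_le1 word_prob_ge0 word_prob_le1 _.
Qed.

Let J_0 x : J 0 x = 0.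
Proof. by rewrite /J /Q block_code_nil ln1 oppr0 if_same. Qed.

Let J_sub m n x : J (m + n)%N x <= J m x + J n (iter m S x).
Proof.
rewrite {1 2}/J; case: ifPn => [/set_mem gx|_]; last by rewrite add0r.
have gmx := good_iter m gx; rewrite /J mem_set// wordD -opprD lerN2.
rewrite -lnM ?posrE ?Q_gt0// ler_ln ?posrE ?mulr_gt0 ?Q_gt0//.
  exact: block_code_cat word_prob_ge0 _ _.
by rewrite -wordD Q_gt0.
Qed.

Let measurable_J n : measurable_fun setT (J n).
Proof.
rewrite (_ : J n = (fun x => - ln (Q (word n x))) \_ good); last first.
  by apply/funext => x; rewrite patchE.
apply/(measurable_restrictT _ measurable_good)/measurable_funTS.
exact: (measurable_countable_comp (measurable_word n) (fun s => - ln (Q s))).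
Qed.

Hypothesis info1 : (\int[P]_x (word_info 1 x)%:E < +oo)%E.

(** Dominates both errors: [ln (n (n + 1))] from the parsing with a single block and [ln (n ^ 2)]
    from Borel-Cantelli. *)
Let r n : R := ln n%:R + ln n%:R + ln 2%:R.

Let r_cvg0 : r n / n%:R @[n --> \oo] --> (0 : R).
Proof.
have -> : (fun n => r n / n%:R) =
    (fun n => ln n%:R / n%:R + ln n%:R / n%:R + ln 2%:R / n%:R).
  by apply/funext => n; rewrite /r !mulrDl.
have l2 : ln 2%:R / n%:R @[n --> \oo] --> (0 : R).
  rewrite -[X in _ --> X](mulr0 (ln 2%:R)); apply: cvgMr.
  rewrite gtr0_cvgV0; first exact: cvgr_idn.
  by near=> n; rewrite ltr0n; near: n; exact: nbhs_infty_gt.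
have := cvgD (cvgD ln_nat_div_cvg0 ln_nat_div_cvg0) l2; rewrite !addr0; exact.
Unshelve. all: by end_near. Qed.

Let J_le_info n x : (0 < n)%N -> J n x <= word_info n x + r n.
Proof.
move=> n0; have n1 : 0 < n%:R :> R by rewrite ltr0n.
have r0 : 0 <= r n by rewrite !addr_ge0 ?ln_ge0 ?ler1n.
rewrite /J; case: ifPn => [/set_mem gx|_]; last by rewrite addr_ge0 ?word_info_ge0.
have := @block_code_single _ _ _ word_prob_ge0 (word n x).
rewrite size_word => /(_ n0) h.
have w0 : 0 < block_weight n :> R := block_weight_gt0 n0.
have : ln (block_weight n * word_prob (word n x)) <= ln (Q (word n x)).
  by rewrite ler_ln ?posrE ?Q_gt0// mulr_gt0.
rewrite lnM ?posrE// /word_info => {}h.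
have : - ln (block_weight n) <= r n.
  rewrite /block_weight lnV ?opprK ?posrE ?mulr_gt0// /r -!lnM ?posrE ?mulr_gt0//.
  rewrite ler_ln ?posrE ?mulr_gt0// -mulrA ler_pM2l// -natrM ler_nat.
  by lia.
by lra.
Qed.

Let J1_int : P.-integrable setT (EFin \o J 1).
Proof.
have r1_ge0 : 0 <= r 1 by rewrite /r ln1 !add0r ln_ge0// ler1n.
apply/integrableP; split; first exact/measurable_EFinP.
apply: (@le_lt_trans _ _ (\int[P]_x ((word_info 1 x)%:E + (r 1)%:E))%E).
  apply: ge0_le_integral => //.
  - exact/measurableT_comp/measurable_EFinP.
  - by apply/measurable_EFinP; apply: measurable_funD => //; exact: measurable_word_info.
  - by move=> x _; rewrite -EFinD lee_fin ger0_norm// J_le_info.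
rewrite ge0_integralD//=.
- rewrite lte_add_pinfty// (integral_cst P measurableT).
  by rewrite lte_mul_pinfty ?lee_fin ?r1_ge0// (le_lt_trans (probability_le1 P measurableT)) ?ltry.
- by move=> x _; rewrite lee_fin word_info_ge0.
- exact/measurable_EFinP/measurable_word_info.
Qed.

Let mean n := mean_sub (P := P) J n.

(** [Q] has mass at most 1 on each length separately, while labels range over words of all lengths;
    hence the cut to length [n]. *)
Let g (n : nat) (s : seq K) := if size s == n then Q s else 0.

Let g_ge0 n s : 0 <= g n s.
Proof. by rewrite /g; case: ifP => // _; exact: block_code_ge0 word_prob_ge0 _. Qed.

Let g_mass n : (\esum_(s in [set: seq K]) (g n s)%:E <= 1)%E.
Proof.
apply: le_trans (esum_block_code_le1 word_prob_ge0 word_prob_mass n).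
rewrite [leRHS]esum_mkcond; apply: le_esum => s _; rewrite /g.
case: ifPn => [/eqP sn|sn]; first by rewrite mem_set.
by rewrite memNset//; apply/eqP.
Qed.

Let info_le_J : {ae P, forall x, \forall n \near \oo, word_info n x <= J n x + r n}.
Proof.
have PT : (P setT < +oo)%E by rewrite (le_lt_trans (probability_le1 P measurableT))// ltry.
apply: filterS2 good_ae (ae_weight_le_density measurable_word g_ge0 PT g_mass).
move=> x gx [m _ hm]; exists m.+1 => // n /= mn.
have n1 : 0 < n%:R :> R by rewrite ltr0n; apply: leq_trans mn.
have := hm n (ltnW mn); rewrite /= /g size_word eqxx word_probE /= => h.
have : ln (Q (word n x)) <= ln (n%:R ^+ 2 * word_prob (word n x)).
  by rewrite ler_ln ?posrE ?Q_gt0// mulr_gt0// exprn_gt0.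
rewrite expr2 !lnM ?posrE ?mulr_gt0// /J mem_set// /word_info /r => {}h.
have : 0 <= ln 2%:R :> R by rewrite ln_ge0// ler1n.
by lra.
Qed.

(* Gibbs: pointwise - ln mu + 1 <= - ln Q + Q / mu, where Q / mu has integral at
   most 1. *)
Let integral_info_le n : (\int[P]_x (word_info n x)%:E <= (mean n)%:E)%E.
Proof.
rewrite -(mean_subE Smp J_ge0 J_0 J_sub)//.
have mD : measurable_fun setT
    (fun x => (g n (word n x) / fine (P (word n @^-1` [set word n x])))%:E).
  exact: (measurable_countable_comp (measurable_word n)
    (fun s => (g n s / fine (P (word n @^-1` [set s])))%:E)).
have D0 x : (0 <= (g n (word n x) / fine (P (word n @^-1` [set word n x])))%:E)%E.
  by rewrite lee_fin divr_ge0 ?g_ge0 ?fine_ge0.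
have mI : measurable_fun setT (fun x => (word_info n x)%:E).
  by apply/measurable_EFinP; exact: measurable_word_info.
have mJE : measurable_fun setT (fun x => (J n x)%:E) by exact/measurable_EFinP.
rewrite -(@leeD2rE _ 1%E)//.
apply: (@le_trans _ _ (\int[P]_x ((J n x)%:E +
    (g n (word n x) / fine (P (word n @^-1` [set word n x])))%:E))%E); last first.
  rewrite ge0_integralD//=; last by move=> x _; rewrite lee_fin.
  rewrite leeD2l//; apply: le_trans (g_mass n).
  apply: (integral_density_le (measurable_word n) (g_ge0 n)) => s.
  by rewrite (le_lt_trans (probability_le1 P _)) ?ltry//; exact: measurable_word.
have -> : (\int[P]_x (word_info n x)%:E + 1 = \int[P]_x ((word_info n x)%:E + 1))%E.
  rewrite ge0_integralD//=; last by move=> x _; rewrite lee_fin word_info_ge0.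
  congr (_ + _)%E; rewrite (integral_cst P measurableT 1%E) mul1e.
  by apply/esym; exact: probability_setT.
apply: ae_ge0_le_integral => //.
- by move=> x _; rewrite -EFinD lee_fin addr_ge0// word_info_ge0.
- exact: emeasurable_funD.
- by move=> x _; rewrite adde_ge0// lee_fin.
- exact: emeasurable_funD.
apply: filterS good_ae => x gx _.
rewrite word_probE /g size_word eqxx /= -EFinD lee_fin /J mem_set// /word_info.
have p0 := gx n; have q0 := Q_gt0 n gx.
have := @le_ln1Dx R (Q (word n x) / word_prob (word n x) - 1).
rewrite addrCA subrr addr0 ltrBrDl subrr divr_gt0// => /(_ isT).
by rewrite ln_div ?posrE//; lra.
Qed.

(** The information and [J n] differ by at most [r n], eventually at almost every point and also in
    mean, so both limits are the rate of [J]. A single [h] is what ties the pointwise limit to the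
    entropy of the partition. *)
Theorem shannon_mcmillan_breiman : exists h : R,
  ((n%:R^-1)%:E * \int[P]_x (word_info n x)%:E)%E @[n --> \oo] --> h%:E /\
  {ae P, forall x, word_info n x / n%:R @[n --> \oo] --> h}.
Proof.
exists (rate (P := P) J); split; last first.
  have JS := subadditive_cvg Smp Serg J_ge0 J_0 J_sub measurable_J J1_int.
  apply: filterS3 good_ae info_le_J JS => x gx xJ xh.
  apply: (cvg_div_close xh r_cvg0).
  apply: filterS2 xJ (nbhs_infty_gt 0) => n h1 n0.
  have h2 := J_le_info x n0.
  by rewrite ler_norml; apply/andP; split; lra.
have meanE := mean_sub_rate_cvg Smp Serg J_ge0 J_0 J_sub measurable_J J1_int.
have Hfin n : (\int[P]_x (word_info n x)%:E)%E \is a fin_num.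
  rewrite ge0_fin_numE; last by apply: integral_ge0 => x _; rewrite lee_fin word_info_ge0.
  by rewrite (le_lt_trans (integral_info_le n))// ltry.
have -> : (fun n => (n%:R^-1)%:E * \int[P]_x (word_info n x)%:E)%E =
    (fun n => (fine (\int[P]_x (word_info n x)%:E)%E / n%:R)%:E).
  by apply/funext => n; rewrite -[X in (_ * X)%E]fineK// -EFinM mulrC.
apply: cvg_EFin; first exact: nearW.
apply: (cvg_div_close meanE r_cvg0); apply: filterS (nbhs_infty_gt 0) => n n0.
have up : fine (\int[P]_x (word_info n x)%:E)%E <= mean n.
  by rewrite -lee_fin fineK// integral_info_le.
have r0 : 0 <= r n by rewrite !addr_ge0 ?ln_ge0 ?ler1n.
have lo : mean n <= fine (\int[P]_x (word_info n x)%:E)%E + r n.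
  have mE : (\int[P]_x (J n x)%:E = (mean n)%:E)%E by apply: (mean_subE Smp J_ge0 J_0 J_sub measurable_J J1_int).
  rewrite -lee_fin EFinD -mE fineK//.
  have -> : (\int[P]_x (word_info n x)%:E + (r n)%:E =
      \int[P]_x ((word_info n x)%:E + (r n)%:E))%E.
    rewrite ge0_integralD//=.
    + congr (_ + _)%E; rewrite (integral_cst P measurableT) -[LHS]mule1.
      by congr (_ * _)%E; apply/esym; exact: probability_setT.
    + by move=> x _; rewrite lee_fin word_info_ge0.
    + exact/measurable_EFinP/measurable_word_info.
  apply: ge0_le_integral => //.
  - by move=> x _; rewrite lee_fin.
  - exact/measurable_EFinP.
  - by apply/measurable_EFinP; apply: measurable_funD => //; exact: measurable_word_info.
  - by move=> x _; rewrite -EFinD lee_fin J_le_info.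
by rewrite ler_norml -/(mean n); apply/andP; split; lra.
Qed.

End shannon_mcmillan_breiman.

(** * Induced transformation *)

Section return_times.
Context {X : Type}.
Variables (T : X -> X) (A : set X).
Implicit Types (x y : X) (n : nat).

Definition returns_at x n : Prop :=
  [/\ (1 <= n)%N, A (iter n T x) & forall k, (1 <= k < n)%N -> ~ A (iter k T x)].

(** Infinitely many visits, not just one return: this set is strictly [T]-invariant, which [ergodic]
    demands, and stable under the induced map. *)
Definition recurrent : set X := [set x | forall N, exists2 n, (N <= n)%N & A (iter n T x)].

Lemma returns_at_inj x n k : returns_at x n -> returns_at x k -> n = k.
Proof.
move=> [n1 An nA] [k1 Ak kA]; case: (ltngtP n k) => // lt.
  by exfalso; apply: (kA n) => //; rewrite n1.
by exfalso; apply: (nA k) => //; rewrite k1.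
Qed.

Lemma return_timeE x n : returns_at x n -> return_time T A x = n.
Proof. by move=> rn; apply: (@returns_at_inj x) => //; apply: xgetPex; exists n. Qed.

Lemma return_timeP x : (0 < return_time T A x)%N -> returns_at x (return_time T A x).
Proof. by rewrite /return_time; case: xgetP. Qed.

Lemma returns_atP x n : (0 < n)%N -> returns_at x n <-> return_time T A x = n.
Proof.
by move=> n0; split=> [/return_timeE//|xn]; rewrite -xn; apply: return_timeP; rewrite xn.
Qed.

Lemma return_time_gt0 x n : (0 < n)%N -> A (iter n T x) -> (0 < return_time T A x)%N.
Proof.
move=> n0 An.
have ex : exists n, (0 < n)%N && `[< A (iter n T x) >].
  by exists n; rewrite n0; apply/asboolP.
have [k /andP[k0 /asboolP Ak] kmin] := ex_minnP ex.
rewrite (@return_timeE x k)//; split => // j /andP[j1 jk] Aj.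
by have := kmin j; rewrite j1 (introT (asboolP _) Aj) leqNgt jk => /(_ isT).
Qed.

Lemma recurrent_return_time_gt0 x : recurrent x -> (0 < return_time T A x)%N.
Proof. by move=> /(_ 1%N)[n n1 An]; exact: return_time_gt0 An. Qed.

Lemma recurrent_preimage : T @^-1` recurrent = recurrent.
Proof.
apply/seteqP; split => x /= h N; have [n Nn An] := h N.+1.
- by exists n.+1; [exact: leq_trans (ltnW Nn) _|rewrite iterSr].
- by case: n Nn An => // n Nn; rewrite iterSr => An; exists n.
Qed.

Lemma recurrent_iter n x : recurrent (iter n T x) <-> recurrent x.
Proof.
elim: n => // n <-; rewrite iterS.
by have := recurrent_preimage => /(congr1 (@^~ (iter n T x))) <-.
Qed.

Lemma induced_in x : (0 < return_time T A x)%N -> A (induced T A x).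
Proof. by move=> /return_timeP[]. Qed.

Lemma recurrent_induced x : recurrent x -> recurrent (induced T A x).
Proof. by rewrite /induced recurrent_iter. Qed.

Lemma recurrent_induced_iter n x : recurrent x -> recurrent (iter n (induced T A) x).
Proof. by elim: n => //= n IH /IH; exact: recurrent_induced. Qed.

Lemma induced_shift x : recurrent x -> ~ A (T x) -> induced T A (T x) = induced T A x.
Proof.
move=> rx nA; have := recurrent_return_time_gt0 rx => /return_timeP.
rewrite /induced; move: (return_time T A x) => n [n1 An nAn].
case: n n1 An nAn => [//|[|n]] _ An nAn; first by [].
rewrite (@return_timeE (T x) n.+1) -?iterSr//; split => //; first by rewrite -iterSr.
by move=> k /andP[k1 kn]; rewrite -iterSr; apply: nAn.
Qed.

Lemma induced_hit x : A (T x) -> induced T A x = T x.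
Proof.
by move=> ATx; rewrite /induced (@return_timeE x 1%N)//; split => // -[|[|k]].
Qed.

End return_times.

Section induced_measurable.
Context {d : measure_display} {X : measurableType d} {R : realType}.
Context {m : {measure set X -> \bar R}} {T : X -> X} {A : set X}.
Hypothesis Tmp : measure_preserving m T.
Hypothesis mA : measurable A.

Lemma measurable_recurrent : measurable (recurrent T A).
Proof.
rewrite (_ : recurrent T A =
    \bigcap_N \bigcup_(n in [set n | (N <= n)%N]) (iter n T @^-1` A)).
  apply: bigcapT_measurable => N; apply: bigcup_measurable => n _.
  exact: (measurable_preimage_iter Tmp).
apply/seteqP; split => x.
  by move=> h N _; have [n Nn An] := h N; exists n.
by move=> h N; have [n Nn An] := h N I; exists n.
Qed.

Lemma measurable_return_time n : measurable (return_time T A @^-1` [set n]).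
Proof.
have mpos k : (0 < k)%N -> measurable (return_time T A @^-1` [set k]).
  move=> k0; rewrite (_ : _ @^-1` _ = iter k T @^-1` A `\`
      \bigcup_(j in [set j | (1 <= j < k)%N]) (iter j T @^-1` A)).
    apply: measurableD; first exact: (measurable_preimage_iter Tmp).
    by apply: bigcup_measurable => j _; exact: (measurable_preimage_iter Tmp).
  apply/seteqP; split => x /=.
    by move=> /(@returns_atP _ T A x k k0)[_ Ak nA]; split => // -[j jk]; exact: nA.
  move=> [Ak nA]; apply/(@returns_atP _ T A x k k0); split => // j jk Aj.
  by apply: nA; exists j.
case: n => [|n]; last exact: mpos.
rewrite (_ : _ @^-1` _ = ~` \bigcup_n (return_time T A @^-1` [set n.+1])).
  by apply: measurableC; apply: bigcupT_measurable => k; exact: mpos.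
apply/seteqP; split => x /=; first by move=> x0 [k _] /=; rewrite x0.
move=> h; apply/eqP; rewrite -leqn0 leqNgt; apply/negP => x0; apply: h.
by exists (return_time T A x).-1 => //=; rewrite prednK.
Qed.

Lemma measurable_induced : measurable_fun setT (induced T A).
Proof.
move=> _ B mB; rewrite setTI (_ : _ @^-1` _ =
   \bigcup_n (return_time T A @^-1` [set n] `&` iter n T @^-1` B)).
  apply: bigcupT_measurable => n; apply: measurableI; first exact: measurable_return_time.
  exact: (measurable_preimage_iter Tmp).
apply/seteqP; split => x /=; first by move=> Bx; exists (return_time T A x).
by move=> [n _ [<-]].
Qed.

End induced_measurable.

Section induced_transformation.
Context {d : measure_display} {X : measurableType d} {R : realType}.
Context {m : {measure set X -> \bar R}} {T : X -> X} {A : set X}.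
Hypothesis Tmp : measure_preserving m T.
Hypothesis Tcons : conservative m T.
Hypothesis Terg : ergodic m T.
Hypothesis mA : measurable A.
Hypothesis A_fin : (0 < m A < +oo)%E.

(* The points of A that never return form a wandering set, so almost every point
   of A returns infinitely often; ergodicity extends this to X. *)
Lemma recurrent_conull : m (~` recurrent T A) = 0%E.
Proof.
have mI n B : measurable B -> measurable (iter n T @^-1` B).
  exact: (measurable_preimage_iter Tmp).
pose W := A `\` \bigcup_(n in [set n | (0 < n)%N]) (iter n T @^-1` A).
have mW : measurable W.
  by apply: measurableD => //; apply: bigcup_measurable => n _; exact: mI.
have W0 : m W = 0%E.
  apply: Tcons; split => // i j _ _ [x [[/= Ai ri] [/= Aj rj]]].
  case: (ltngtP i j) => // lt; exfalso.
    by apply: ri; exists (j - i)%N; rewrite /= ?subn_gt0// -iterD subnK// ltnW.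
  by apply: rj; exists (i - j)%N; rewrite /= ?subn_gt0// -iterD subnK// ltnW.
have mR := measurable_recurrent Tmp mA.
have [R0|//] := Terg mR (recurrent_preimage T A).
have AR : m.-negligible A.
  have : m.-negligible (recurrent T A `|` \bigcup_n (iter n T @^-1` W)).
    apply: negligibleU; first exact/negligibleP.
    apply: negligible_bigcup => n; apply: (negligible_preimage_iter Tmp).
    exact/negligibleP.
  apply: negligibleS => x Ax.
  have [rx|rx] := pselect (recurrent T A x); [by left|right].
  have [N HN] : exists N, forall n, (N <= n)%N -> ~ A (iter n T x).
    apply: contrapT => h; apply: rx => N; apply: contrapT => h'; apply: h.
    by exists N => n Nn An; apply: h'; exists n.
  have ex : exists n, `[< A (iter n T x) >] by exists 0%N; apply/asboolP.
  have bd n : `[< A (iter n T x) >] -> (n <= N)%N.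
    by move=> /asboolP An; rewrite leqNgt; apply/negP => /ltnW /HN.
  (* The last visit of a non-recurrent point of [A] is a point of [W]. *)
  have [k /asboolP Ak kmax] := ex_maxnP ex bd.
  exists k => //; split => // -[j /= j0]; rewrite -iterD => /asboolP /kmax.
  by rewrite leqNgt -[X in (X < _)%N]add0n ltn_add2r j0.
by move/negligibleP : AR => /(_ mA) A0; move: A_fin; rewrite A0 ltxx.
Qed.

Lemma recurrent_ae : {ae m, forall x, recurrent T A x}.
Proof.
exists (~` recurrent T A); split => //; last exact: recurrent_conull.
exact: measurableC (measurable_recurrent Tmp mA).
Qed.

Variable P : probability X R.
Hypothesis PE : forall B, measurable B -> P B = (cond_measure m A B)%:E.

Lemma measure_cap_fin B : measurable B -> m (B `&` A) \is a fin_num.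
Proof.
move=> mB; rewrite ge0_fin_numE//; case/andP : A_fin => _; apply: le_lt_trans.
by apply: le_measure; rewrite ?inE//; exact: measurableI.
Qed.

Lemma cond_measure_mass : 0 < fine (m A).
Proof. by rewrite fine_gt0. Qed.

Lemma measure_capE B : measurable B -> m (B `&` A) = ((fine (m A))%:E * P B)%E.
Proof.
move=> mB; rewrite PE// /cond_measure -EFinM mulrC divfK ?gt_eqF ?cond_measure_mass//.
by rewrite fineK// measure_cap_fin.
Qed.

Lemma cond_null B : measurable B -> P B = 0%E <-> m (B `&` A) = 0%E.
Proof.
move=> mB; rewrite measure_capE//; split=> [->|/eqP]; first by rewrite mule0.
by rewrite mule_eq0 eqe gt_eqF ?cond_measure_mass//= => /eqP.
Qed.

Lemma cond_conull : P (A `&` recurrent T A) = 1%E.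
Proof.
have mR := measurable_recurrent Tmp mA.
rewrite PE /cond_measure; last exact: measurableI.
rewrite setIAC setIid (_ : m _ = m A) ?divff ?gt_eqF ?cond_measure_mass//.
rewrite [RHS](measureDI m mA mR) [X in (X + _)%E](_ : _ = 0%E) ?add0e//.
apply: subset_measure0 recurrent_conull => //; first exact: measurableD.
exact: measurableC.
Qed.

Let S := induced T A.

Let mS B : measurable B -> measurable (S @^-1` B).
Proof. by move=> mB; rewrite -[X in measurable X]setTI; exact: (measurable_induced Tmp mA). Qed.

(* Peeling off the points of A first entering B `&` A at time n. *)
Let induced_le B : measurable B -> (m (S @^-1` B `&` A) <= m (B `&` A))%E.
Proof.
move=> mB; have mR := measurable_recurrent Tmp mA.
have mI n C : measurable C -> measurable (iter n T @^-1` C).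
  exact: (measurable_preimage_iter Tmp).
have mrt := measurable_return_time Tmp mA.
pose F k := A `&` (return_time T A @^-1` [set k.+1] `&` S @^-1` B).
pose Rn n := (iter n T @^-1` (B `&` A)) `\`
  \bigcup_(j in [set j | (j < n)%N]) (iter j T @^-1` A).
have mF k : measurable (F k).
  by apply: measurableI => //; apply: measurableI; [exact: mrt|exact: mS].
have mRn n : measurable (Rn n).
  apply: measurableD; first by apply: mI; exact: measurableI.
  by apply: bigcup_measurable => j _; exact: mI.
have peel n : (\sum_(0 <= k < n) m (F k) + m (Rn n) <= m (B `&` A))%E.
  elim: n => [|n IH].
    rewrite big_geq// add0e le_measure ?inE//; first exact: measurableI.
    by move=> x [].
  apply: le_trans IH; rewrite big_nat_recr//= -addeA leeD2l//.
  rewrite -(measure_preimage_iter Tmp 1 (mRn n)) -measureU//; last first.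
    apply/seteqP; split => // x [[Ax _] [_ nA]].
    by apply: nA; exists 0%N.
  apply: le_measure; rewrite ?inE; [exact: measurableU|exact: mI|].
  move=> x [[Ax [/= /(@returns_atP _ T A x n.+1 isT) rx Sx]]|[/= Bx nA]].
    have rE := return_timeE rx; move: Sx; rewrite /S /induced rE => Sx.
    case: rx => _ Anx nA; split; rewrite /preimage/= -iterS iterSr in Anx Sx *; first by [].
    by move=> [j /= jn]; rewrite -iterSr; apply: nA.
  rewrite /preimage /= -iterS iterSr in Bx *; split => //.
  by move=> [j /= jn]; rewrite -iterSr => Aj; apply: nA; exists j.+1.
have mU : measurable (\bigcup_k F k) by exact: bigcupT_measurable.
have le1 : (m (S @^-1` B `&` A) <= m (\bigcup_k F k))%E.
  rewrite -(measureU0 mU (measurableC mR) recurrent_conull).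
  apply: le_measure; rewrite ?inE.
  - by apply: measurableI => //; exact: mS.
  - by apply: measurableU => //; exact: measurableC.
  - move=> x [Sx Ax]; have [rx|rx] := pselect (recurrent T A x); [left|by right].
    have := recurrent_return_time_gt0 rx => x0.
    by exists (return_time T A x).-1 => //; split => //; split => //=; rewrite prednK.
apply: le_trans le1 _; rewrite measure_semi_bigcup//; last first.
  by move=> i j _ _ [x [[_ [/= xi _]] [_ [/= xj _]]]]; apply: succn_inj; rewrite -xi -xj.
apply: lime_le; first exact: is_cvg_nneseries.
by apply: nearW => n; apply: le_trans (peel n); rewrite leeDl.
Qed.

Let cond_induced_le B : measurable B -> (P (S @^-1` B) <= P B)%E.
Proof.
move=> mB; have := induced_le mB; rewrite !measure_capE//; last exact: mS.
by rewrite lee_pmul2l// ?lte_fin ?cond_measure_mass.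
Qed.

(** The inequality [cond_induced_le] holds for [B] and for its complement; as the total mass is 1,
    both are equalities. *)
Lemma induced_measure_preserving : measure_preserving P S.
Proof.
split; first exact: (measurable_induced Tmp mA).
move=> B mB; apply/eqP; rewrite eq_le cond_induced_le//=.
have := cond_induced_le (measurableC mB).
rewrite preimage_setC !probability_setC//; last exact: mS.
by rewrite !PE//; [rewrite -!EFinB !lee_fin lerD2l lerN2|exact: mS].
Qed.

(** For recurrent [x], either [S x = T x] or [S (T x) = S x], so [T] does not change membership in
    an [S]-invariant set. Intersecting with [recurrent] makes the set strictly [T]-invariant. *)
Lemma induced_ergodic : ergodic P S.
Proof.
move=> B mB SB; have mR := measurable_recurrent Tmp mA.
pose C := B `&` recurrent T A.
have mC : measurable C by exact: measurableI.
have BS x : B x <-> B (S x) by rewrite -[in B x]SB.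
have TC : T @^-1` C = C.
  have key x : recurrent T A x -> B (T x) <-> B x.
    move=> rx; have [ATx|ATx] := pselect (A (T x)).
      by rewrite (BS x) /S induced_hit.
    by rewrite (BS x) (BS (T x)) /S induced_shift.
  have rT x : recurrent T A (T x) <-> recurrent T A x.
    exact: (recurrent_iter T A 1).
  apply/seteqP; split => x [].
    by move=> BTx /rT rx; split => //; apply/(key x rx).
  by move=> Bx rx; split; [apply/(key x rx)|apply/rT].
have [C0|C0] := Terg mC TC; [left|right].
  have U0 : m (C `|` ~` recurrent T A) = 0%E.
    by rewrite measureU0// ?recurrent_conull//; exact: measurableC.
  apply/(cond_null mB); apply: subset_measure0 U0.
  - exact: measurableI.
  - by apply: measurableU => //; exact: measurableC.
  - by move=> x [Bx Ax]; have [rx|rx] := pselect (recurrent T A x); [left|right].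
apply/(cond_null (measurableC mB)); apply: subset_measure0 C0.
- by apply: measurableI => //; exact: measurableC.
- exact: measurableC.
- by move=> x [Bx _] [].
Qed.

(** Carries statements about [P], which only concern [A], to almost every point of [X]: a bad
    entrance point puts [x] in one of countably many preimages of a null subset of [A]. *)
Lemma ae_induced (Q : X -> Prop) : {ae P, forall x, Q x} -> {ae m, forall x, Q (S x)}.
Proof.
move=> [N [mN N0 QN]].
have NA : m.-negligible (N `&` A).
  by apply/negligibleP; [exact: measurableI|exact/cond_null].
have : m.-negligible (~` recurrent T A `|` \bigcup_n (iter n T @^-1` (N `&` A))).
  apply: negligibleU; first exact: recurrent_ae.
  by apply: negligible_bigcup => n; exact: (negligible_preimage_iter Tmp).
apply: negligibleS => x /= Qx.
have [rx|rx] := pselect (recurrent T A x); [right|by left].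
exists (return_time T A x) => //=; split; first exact: QN.
exact: (induced_in (recurrent_return_time_gt0 rx)).
Qed.

End induced_transformation.

(** * Entropy of partitions and labels *)

Section label_information.
Context {d : measure_display} {X : measurableType d} {R : realType}.
Variable P : probability X R.

Definition label_info {K : countType} (N : X -> K) (x : X) : R :=
  - ln (fine (P (N @^-1` [set N x]))).

Lemma fine_probability_le1 B : measurable B -> fine (P B) <= 1.
Proof.
by move=> mB; rewrite -lee_fin fineK ?fin_num_measure//; exact: probability_le1.
Qed.

Lemma label_info_ge0 {K : countType} (N : X -> K) x :
  (forall k, measurable (N @^-1` [set k])) -> 0 <= label_info N x.
Proof. by move=> mN; rewrite oppr_ge0 ln_le0// fine_probability_le1. Qed.

Lemma measurable_label_info {K : countType} (N : X -> K) :
  (forall k, measurable (N @^-1` [set k])) -> measurable_fun setT (label_info N).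
Proof.
by move=> mN; exact: (measurable_countable_comp mN (fun k => - ln (fine (P (N @^-1` [set k]))))).
Qed.

Lemma label_mass {K : countType} (N : X -> K) :
  (forall k, measurable (N @^-1` [set k])) ->
  (\esum_(k in [set: K]) (fine (P (N @^-1` [set k])))%:E <= 1)%E.
Proof.
move=> mN; have <- : (\int[P]_x (cst 1%E : X -> \bar R) x = 1)%E.
  by rewrite (integral_cst P measurableT 1%E) mul1e; exact: probability_setT.
rewrite (@ge0_integral_countable_comp _ _ _ _ _ mN P (cst 1%E))//.
by apply: le_esum => k _; rewrite mul1e fineK// fin_num_measure.
Qed.

(* With p1, p2 and p12 the laws of the two labels and of the pair,
   - ln p12 <= - ln p1 - ln p2 + p1 p2 / p12, and the last term has integral at most 1. *)
Lemma pair_label_info_lty {K1 K2 : countType} (N1 : X -> K1) (N2 : X -> K2) :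
  (forall k, measurable (N1 @^-1` [set k])) ->
  (forall k, measurable (N2 @^-1` [set k])) ->
  (\int[P]_x (label_info N1 x)%:E < +oo)%E ->
  (\int[P]_x (label_info N2 x)%:E < +oo)%E ->
  (\int[P]_x (label_info (fun x => (N1 x, N2 x)) x)%:E < +oo)%E.
Proof.
move=> m1 m2 i1 i2; pose N x := (N1 x, N2 x).
pose p1 k := fine (P (N1 @^-1` [set k])); pose p2 k := fine (P (N2 @^-1` [set k])).
pose p k := fine (P (N @^-1` [set k])).
have NE k : N @^-1` [set k] = N1 @^-1` [set k.1] `&` N2 @^-1` [set k.2].
  by case: k => k1 k2; apply/seteqP; split => x /=; [move=> [-> ->]|move=> [<- <-]].
have mN k : measurable (N @^-1` [set k]) by rewrite NE; exact: measurableI.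
have p_le1 k : p k <= p1 k.1.
  rewrite fine_le ?fin_num_measure// NE; apply: le_measure; rewrite ?inE//.
  exact: measurableI.
have p_le2 k : p k <= p2 k.2.
  rewrite fine_le ?fin_num_measure// NE; apply: le_measure; rewrite ?inE//.
  exact: measurableI.
pose g k := p1 k.1 * p2 k.2.
have g0 k : 0 <= g k by rewrite mulr_ge0// fine_ge0.
have g1 : (\esum_(k in [set: K1 * K2]) (g k)%:E <= 1)%E.
  rewrite (_ : setT = [set: K1] `*`` (fun=> [set: K2])); last by apply/seteqP; split.
  rewrite -(@esum_esum _ _ _ _ _ (fun i j => (p1 i * p2 j)%:E)); last first.
    by move=> i j _ _; rewrite lee_fin mulr_ge0// fine_ge0.
  apply: le_trans (label_mass m1); apply: le_esum => i _.
  rewrite (eq_esum (b := fun j => ((p1 i)%:E * (p2 j)%:E)%E)); last by move=> j _; rewrite EFinM.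
  apply: (le_trans (esumZl_le _ (fine_ge0 _) _)) => //.
    by move=> j; rewrite lee_fin fine_ge0.
  by rewrite -[leRHS]mule1 lee_wpmul2l ?lee_fin ?fine_ge0// label_mass.
have dens := integral_density_le mN g0 (fun k => le_lt_trans (probability_le1 P (mN k)) (ltry _)).
have mD : measurable_fun setT (fun x => (g (N x) / fine (P (N @^-1` [set N x])))%:E).
  exact: (measurable_countable_comp mN (fun k => (g k / fine (P (N @^-1` [set k])))%:E)).
have mE (K : countType) (L : X -> K) : (forall k, measurable (L @^-1` [set k])) ->
    measurable_fun setT (fun x => (label_info L x)%:E).
  by move=> mL; apply/measurable_EFinP; exact: measurable_label_info.
apply: (@le_lt_trans _ _ (\int[P]_x ((label_info N1 x)%:E + (label_info N2 x)%:E +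
    (g (N x) / fine (P (N @^-1` [set N x])))%:E))%E).
  apply: ge0_le_integral => //.
  - by move=> x _; rewrite lee_fin label_info_ge0.
  - exact: mE.
  - by do 2 ?apply: emeasurable_funD => //; exact: mE.
  - move=> x _; rewrite -!EFinD lee_fin /label_info -/(p (N x)) -/(p1 _) -/(p2 _).
    (* At a pair of probability 0 the convention [ln 0 = 0] makes the left side vanish. *)
    have [p0|p0] := ltP 0 (p (N x)); last first.
      rewrite (ln0 p0) oppr0 !addr_ge0 ?divr_ge0 ?fine_ge0//;
      by rewrite oppr_ge0 ln_le0// fine_probability_le1.
    have p10 := lt_le_trans p0 (p_le1 (N x)); have p20 := lt_le_trans p0 (p_le2 (N x)).
    have := @ln_sublinear R (g (N x) / p (N x)).
    rewrite divr_gt0 ?mulr_gt0// => /(_ isT).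
    rewrite ln_div ?posrE ?mulr_gt0// lnM ?posrE//= => h.
    by move: p0 p10 p20 h; rewrite /g /=; lra.
rewrite ge0_integralD//=; last 3 first.
- by move=> x _; rewrite adde_ge0// lee_fin label_info_ge0.
- by apply: emeasurable_funD; exact: mE.
- by move=> x _; rewrite lee_fin divr_ge0// fine_ge0.
rewrite ge0_integralD//=; last 4 first.
- by move=> x _; rewrite lee_fin label_info_ge0.
- exact: mE.
- by move=> x _; rewrite lee_fin label_info_ge0.
- exact: mE.
apply: lte_add_pinfty; first exact: lte_add_pinfty.
exact: le_lt_trans dens (le_lt_trans g1 (ltry _)).
Qed.

Lemma probability_eq_on Z B C : measurable Z -> P (~` Z) = 0%E ->
  measurable B -> measurable C -> (forall x, Z x -> B x <-> C x) -> P B = P C.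
Proof.
move=> mZ Z0 mB mC BC.
have key D : measurable D -> P D = P (D `&` Z).
  move=> mD; rewrite [LHS](measureDI P mD mZ) [X in (X + _)%E](_ : _ = 0%E) ?add0e//.
  apply: subset_measure0 Z0 => //; [exact: measurableD|exact: measurableC].
rewrite (key B)// (key C)//; congr (P _).
by apply/seteqP; split => x [h Zx]; split => //; apply/(BC x Zx).
Qed.

End label_information.

Section entropy_label.
Context {d : measure_display} {X : measurableType d} {R : realType}.
Context {m : {measure set X -> \bar R}} {A : set X}.
Variable P : probability X R.
Hypothesis PE : forall B, measurable B -> P B = (cond_measure m A B)%:E.

(** Bridge from a sum over blocks, which are sets, to the integral of the information of a label
    that names the blocks on the conull set [Z]. Null blocks and null labels contribute 0, and the
    remaining ones correspond bijectively. *)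
Lemma entropy_label_info (al : set (set X)) (Z : set X) (blk : X -> set X)
    {K : countType} (N : X -> K) :
  measurable Z -> P (~` Z) = 0%E ->
  (forall k, measurable (N @^-1` [set k])) ->
  (forall c, al c -> measurable c) ->
  (forall x, Z x -> al (blk x)) ->
  (forall x c, Z x -> al c -> c x -> c = blk x) ->
  (forall x y, Z x -> Z y -> blk x y <-> N y = N x) ->
  entropy m A al = (\int[P]_x (label_info P N x)%:E)%E.
Proof.
move=> mZ Z0 mN mal blk_al blk_uniq blk_N.
pose p k := fine (P (N @^-1` [set k])).
pose D := [set k | P (N @^-1` [set k]) != 0%E].
have pE k : P (N @^-1` [set k]) = (p k)%:E by rewrite fineK// fin_num_measure.
have PblkE x : Z x -> P (blk x) = P (N @^-1` [set N x]).
  move=> Zx; apply: (@probability_eq_on _ _ _ P Z) => //; first exact/mal/blk_al.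
  by move=> y Zy; exact: blk_N.
have meet B : measurable B -> P B != 0%E -> exists2 x, Z x & B x.
  move=> mB B0; apply: contrapT => h; move/eqP : B0; apply.
  apply: subset_measure0 Z0 => //; first exact: measurableC.
  by move=> x Bx Zx; apply: h; exists x.
(* The block of any point of [Z] with label [k]; such a point exists as soon as the label has
   positive probability. *)
pose e k := xget set0 [set c | exists2 x, Z x /\ N x = k & c = blk x].
have eP k : D k -> exists2 x, Z x /\ N x = k & e k = blk x.
  move=> Dk; have [x Zx Nx] := meet _ (mN k) Dk.
  by apply: (@xgetPex _ set0 [set c | exists2 x, Z x /\ N x = k & c = blk x]);
    exists (blk x); exists x.
have eprob k : D k -> P (e k) = (p k)%:E.
  by move=> Dk; have [x [Zx <-] ->] := eP k Dk; rewrite PblkE// pE.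
have condE c : measurable c -> cond_measure m A (c `&` A) = fine (P c).
  by move=> mc; rewrite PE//= /cond_measure -setIA setIid.
have h0 c : measurable c -> 0 <= fine (P c) * ln (fine (P c))^-1.
  move=> mc; have c1 := fine_probability_le1 P mc.
  have [c0|c0] := ltP 0 (fine (P c)).
    by rewrite mulr_ge0 ?(ltW c0)// lnV ?posrE// oppr_ge0 ln_le0.
  by rewrite (_ : fine _ = 0) ?mul0r//; apply/eqP; rewrite eq_le c0 fine_ge0.
rewrite /entropy (eq_esum (b := fun c => (fine (P c) * ln (fine (P c))^-1)%:E)); last first.
  by move=> c /mal mc; rewrite condE.
rewrite (esumID [set c | P c != 0%E]); last by move=> c /mal mc; rewrite lee_fin h0.
rewrite [X in (_ + X)%E]esum1 ?adde0; last first.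
  by move=> c [_ /= /negP]; rewrite negbK => /eqP ->; rewrite mul0r.
rewrite (@ge0_integral_countable_comp _ _ _ _ _ mN P (fun k => (- ln (p k))%:E)); last first.
  by move=> k; rewrite lee_fin /= oppr_ge0 ln_le0// fine_probability_le1.
rewrite [RHS](esumID D); last first.
  by move=> k _; rewrite mule_ge0// lee_fin oppr_ge0 ln_le0// fine_probability_le1.
rewrite [X in (_ + X)%E]esum1 ?adde0; last first.
  by move=> k [_ /= /negP]; rewrite negbK => /eqP ->; rewrite mule0.
rewrite setTI (reindex_esum D _ e); last first.
  split.
  - move=> k Dk; have [x [Zx Nx] ex] := eP k Dk; rewrite ex; split; first exact: blk_al.
    by rewrite /= PblkE// Nx.
  - move=> k k' /set_mem Dk /set_mem Dk' ekk'.
    have [x [Zx Nx] ex] := eP k Dk; have [x' [Zx' Nx'] ex'] := eP k' Dk'.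
    have : blk x x by apply/blk_N.
    by rewrite -ex ekk' ex' => /(blk_N _ _ Zx' Zx); rewrite Nx Nx'.
  - move=> c [ac c0]; have [x Zx cx] := meet _ (mal _ ac) c0.
    have cE := blk_uniq _ _ Zx ac cx.
    have Dx : D (N x) by rewrite /D/= -PblkE// -cE.
    exists (N x) => //; have [y [Zy Ny] ->] := eP _ Dx.
    by rewrite cE; apply: blk_uniq => //; [exact: blk_al|exact/blk_N].
apply: eq_esum => k Dk; rewrite eprob//= pE -EFinM mulrC lnV// posrE.
by rewrite lt_neqAle fine_ge0// andbT eq_sym -eqe -pE.
Qed.

End entropy_label.

(** * Itineraries and visits *)

Section partition_blocks.
Context {d : measure_display} {X : measurableType d}.
Variable xi : set (set X).
Hypothesis xi_part : countable_partition xi.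

Let b := pblock xi id.

Lemma pblockP x : xi (b x) /\ b x x.
Proof.
have [_ _ _ xiT] := xi_part.
have [c xic cx] : cover xi id x by rewrite xiT.
by apply: (@xgetPex _ point [set c | xi c /\ c x]); exists c.
Qed.

Lemma pblock_uniq x c : xi c -> c x -> c = b x.
Proof.
have [_ _ xi_triv _] := xi_part.
by move=> xic cx; have [xib bx] := pblockP x; apply: xi_triv => //; exists x.
Qed.

Lemma pblock_eqP x y : b y = b x <-> b x y.
Proof.
split=> [<-|bxy]; first by have [] := pblockP y.
by rewrite -(@pblock_uniq y (b x))//; have [] := pblockP x.
Qed.

Lemma measurable_pblock x : measurable (b x).
Proof. by have [_ xi_meas _ _] := xi_part; apply: xi_meas; have [] := pblockP x. Qed.

Lemma measurable_pblock_code (code : set X -> nat) :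
  {in xi &, injective code} -> forall j, measurable ((code \o b) @^-1` [set j]).
Proof.
move=> code_inj j; have [_ xi_meas _ _] := xi_part.
have [[x xj]|h] := pselect (exists x, code (b x) = j); last first.
  by rewrite (_ : _ @^-1` _ = set0)//; apply/seteqP; split => // x /= xj; apply: h; exists x.
rewrite (_ : _ @^-1` _ = b x); first exact: measurable_pblock.
apply/seteqP; split => y /=.
  rewrite -xj => /code_inj yx; apply/pblock_eqP; apply: yx; rewrite inE;
  by have [] := pblockP x; have [] := pblockP y.
by move=> /pblock_eqP ->.
Qed.

Lemma pblock_itinerary (T : X -> X) n x :
  pblock (itinerary T xi 1 n) id x =
  [set y | forall j, (1 <= j <= n)%N -> b (iter j T y) = b (iter j T x)].
Proof.
set B := [set y | _].
have BE : B = \bigcap_(j in [set j | (1 <= j <= n)%N]) (iter j T @^-1` b (iter j T x)).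
  by apply/seteqP; split => y h j jn; apply/pblock_eqP; apply: h.
have uniq c : itinerary T xi 1 n c -> c x -> c = B.
  move=> [a [xia ->]] ax; rewrite BE; apply: eq_bigcapr => j jn.
  by congr (_ @^-1` _); apply: pblock_uniq; [exact: xia|exact: ax].
have : itinerary T xi 1 n (pblock_index (itinerary T xi 1 n) id x) /\
    pblock_index (itinerary T xi 1 n) id x x.
  apply: (@xgetPex _ point [set c | itinerary T xi 1 n c /\ c x]); exists B; split => //.
  exists (fun j => b (iter j T x)); split => // j _.
  by have [] := pblockP (iter j T x).
by move=> [h1 h2]; exact: uniq.
Qed.

End partition_blocks.

Section visits.
Context {d : measure_display} {X : measurableType d}.
Variables (T : X -> X) (A : set X) (xi : set (set X)) (code : set X -> nat).
Hypothesis xi_part : countable_partition xi.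
Hypothesis xiA : xi (~` A).
Hypothesis code_inj : {in xi &, injective code}.

Let S := induced T A.
Let b := pblock xi id.

Definition return_label (x : X) : nat * nat := (return_time T A x, code (b x)).

Definition visit_time (i : nat) (x : X) : nat :=
  \sum_(0 <= l < i) return_time T A (iter l S x).

Definition visit_count (n : nat) (x : X) : nat :=
  \sum_(1 <= j < n.+1) (iter j T x \in A).

Lemma visit_timeS i x :
  visit_time i.+1 x = (visit_time i x + return_time T A (iter i S x))%N.
Proof. by rewrite /visit_time big_nat_recr. Qed.

Lemma visit_time0 x : visit_time 0 x = 0%N.
Proof. by rewrite /visit_time big_geq. Qed.

Lemma iter_induced i x : iter i S x = iter (visit_time i x) T x.
Proof.
elim: i => [|i IH]; first by rewrite visit_time0.
by rewrite visit_timeS addnC iterD -IH.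
Qed.

Lemma visit_time_le i k x : (i <= k)%N -> (visit_time i x <= visit_time k x)%N.
Proof.
move=> ik; rewrite -(subnKC ik); elim: (k - i)%N => [|l IH]; first by rewrite addn0.
by rewrite addnS visit_timeS (leq_trans IH)// leq_addr.
Qed.

Lemma visit_time_gt0 i x : recurrent T A x -> (0 < visit_time i.+1 x)%N.
Proof.
move=> rx; rewrite visit_timeS ltn_addl//.
exact/recurrent_return_time_gt0/recurrent_induced_iter.
Qed.

Lemma between_visits i j x :
  (visit_time i x < j < visit_time i.+1 x)%N -> ~ A (iter j T x).
Proof.
move=> /andP[ij ji]; rewrite -(subnK (ltnW ij)) iterD -iter_induced.
rewrite visit_timeS in ji; have jr : (0 < j - visit_time i x < return_time T A (iter i S x))%N.
  by rewrite subn_gt0 ij/= ltn_subLR// ltnW.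
have r0 : (0 < return_time T A (iter i S x))%N by case/andP: jr => _; exact: leq_ltn_trans.
by have [_ _ nA] := return_timeP r0; exact: nA.
Qed.

Lemma visit_in i x : recurrent T A x -> A (iter (visit_time i.+1 x) T x).
Proof.
move=> rx; rewrite -iter_induced; apply: induced_in.
exact/recurrent_return_time_gt0/recurrent_induced_iter.
Qed.

Lemma visit_count_time n x : recurrent T A x ->
  (visit_time (visit_count n x) x <= n < visit_time (visit_count n x).+1 x)%N.
Proof.
move=> rx; elim: n => [|n /andP[IH1 IH2]].
  by rewrite /visit_count big_geq// visit_time0/= visit_time_gt0.
have cS : visit_count n.+1 x = (visit_count n x + (iter n.+1 T x \in A))%N.
  by rewrite /visit_count big_nat_recr.
have [e|ne] := eqVneq n.+1 (visit_time (visit_count n x).+1 x).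
  have An : iter n.+1 T x \in A by rewrite mem_set// e; exact: visit_in.
  rewrite cS An addn1 -{1}e leqnn/= visit_timeS -e -[X in (X < _)%N]addn0 ltn_add2l.
  exact/recurrent_return_time_gt0/recurrent_induced_iter.
have lt : (n.+1 < visit_time (visit_count n x).+1 x)%N by rewrite ltn_neqAle ne.
have nA : iter n.+1 T x \notin A.
  by rewrite notin_setE; apply: (@between_visits (visit_count n x)); rewrite lt ltnS IH1.
by rewrite cS (negbTE nA) addn0 lt (leq_trans IH1).
Qed.

Lemma pblock_notin z : ~ A z -> b z = ~` A.
Proof. by move=> nA; apply/esym/(pblock_uniq xi_part xiA). Qed.

Lemma pblock_mem_eq z z' : b z = b z' -> A z -> A z'.
Proof.
move=> zz' Az; apply: contrapT => /pblock_notin bz'.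
have := (pblockP xi_part z).2; rewrite -/b zz' bz'; exact.
Qed.

(** The itinerary starts at time 1, so the block of [x] itself is not read: of [x] only the return
    time is recorded, and labels begin at [S x]. *)
Definition visit_cell (k : nat) (x : X) : set X :=
  [set y | return_time T A y = return_time T A x /\
           word (S := S) return_label k (S y) = word (S := S) return_label k (S x)].

(** The cell fixes the return times at the iterates of index 0 to [k], hence all visit times up to
    index [k + 1]. Up to time [n] the blocks at visits are letters of the word, and between visits
    they are the complement of [A]. *)
Lemma visit_cell_sub k n x y : (n < visit_time k.+1 x)%N -> visit_cell k x y ->
  forall j, (1 <= j <= n)%N -> b (iter j T y) = b (iter j T x).
Proof.
move=> nk [r0 /word_eqP wk].
have lab i : (0 < i <= k)%N -> return_label (iter i S y) = return_label (iter i S x).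
  by case: i => // i /andP[_ ik]; rewrite !iterSr; exact: wk.
have rt i : (i <= k)%N -> return_time T A (iter i S y) = return_time T A (iter i S x).
  by case: i => // i ik; have [] := lab i.+1 ik.
have bt i : (0 < i <= k)%N -> b (iter i S y) = b (iter i S x).
  by move=> /lab [_]; apply: code_inj; rewrite inE; exact: (pblockP xi_part _).1.
have vt i : (i <= k.+1)%N -> visit_time i y = visit_time i x.
  elim: i => [|i IH] ik; first by rewrite !visit_time0.
  by rewrite !visit_timeS IH ?rt// ltnW.
suff H i : (i <= k.+1)%N -> forall j, (1 <= j < visit_time i x)%N ->
    b (iter j T y) = b (iter j T x).
  move=> j /andP[j1 jn]; apply: (H k.+1) => //.
  by rewrite j1 (leq_ltn_trans jn).
elim: i => [|i IH] ik j; first by rewrite visit_time0 ltn0 andbF.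
move=> /andP[j1 ji]; have [lt|gt|e] := ltngtP j (visit_time i x).
- by apply: IH; [exact: ltnW|rewrite j1].
- rewrite !pblock_notin//; first by apply: (@between_visits i); rewrite gt.
  by apply: (@between_visits i); rewrite !vt ?gt// ltnW.
- rewrite e -{1}vt ?(ltnW ik)// -!iter_induced; apply: bt.
  apply/andP; split; last by rewrite -ltnS.
  by rewrite lt0n; apply: contraTneq j1 => i0; rewrite e i0 visit_time0.
Qed.

(** As the complement of [A] is a block, the itinerary shows when [A] is visited. The return time in
    the last letter is only visible once the next visit has occurred, hence
    [visit_time k.+1 x <= n]. *)
Lemma sub_visit_cell k n x y : recurrent T A x -> (visit_time k.+1 x <= n)%N ->
  (forall j, (1 <= j <= n)%N -> b (iter j T y) = b (iter j T x)) -> visit_cell k x y.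
Proof.
move=> rx kn bxy.
have Axy j : (1 <= j <= n)%N -> A (iter j T y) <-> A (iter j T x).
  by move=> jn; split; apply: pblock_mem_eq; rewrite bxy.
have step i : (i <= k)%N -> visit_time i y = visit_time i x ->
    return_time T A (iter i S y) = return_time T A (iter i S x).
  move=> ik vi; apply: return_timeE.
  have := return_timeP (recurrent_return_time_gt0 (recurrent_induced_iter i rx)).
  set r := return_time T A _ => -[r1 Ar nA].
  have vn : (r + visit_time i x <= n)%N.
    by rewrite addnC -visit_timeS; apply: leq_trans kn; exact: visit_time_le.
  rewrite !iter_induced in Ar nA *; rewrite vi; split => //.
    rewrite -iterD; apply/Axy; last by rewrite iterD.
    by rewrite vn andbT addn_gt0 r1.
  move=> l /andP[l1 lr]; rewrite -iterD => Ay.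
  have ln : (1 <= l + visit_time i x <= n)%N.
    by rewrite addn_gt0 l1/= (leq_trans _ vn)// leq_add2r ltnW.
  by apply: (nA l); [rewrite l1|rewrite -iterD; apply/(Axy _ ln)].
have vt i : (i <= k.+1)%N -> visit_time i y = visit_time i x.
  elim: i => [|i IH] ik; first by rewrite !visit_time0.
  by rewrite !visit_timeS step ?IH// ltnW.
have rt i : (i <= k)%N -> return_time T A (iter i S y) = return_time T A (iter i S x).
  by move=> ik; apply: step => //; apply: vt; exact: leqW.
split; first exact: (rt 0%N).
apply/word_eqP => t tk; rewrite -!iterSr /return_label rt//; congr (_, code _).
rewrite !iter_induced vt ?leqW//; apply: bxy.
by rewrite visit_time_gt0//= (leq_trans _ kn)// visit_time_le// leqW.
Qed.

End visits.

Lemma cond_probability_exists {d : measure_display} {X : measurableType d}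
    {R : realType} (m : {measure set X -> \bar R}) (A : set X) :
  measurable A -> (0 < m A < +oo)%E ->
  exists P : probability X R, forall B, measurable B -> P B = (cond_measure m A B)%:E.
Proof.
move=> mA /andP[A0 Aoo].
have [x0 _] : A !=set0 by apply/set0P; apply: contraTneq A0 => ->; rewrite measure0 ltxx.
(* [dirac x0] is the fallback of [mnormalize] for zero or infinite mass, both excluded here. *)
exists (mnormalize (mrestr m mA) (dirac x0)) => B mB.
have BA : m (B `&` A) \is a fin_num.
  rewrite ge0_fin_numE// (le_lt_trans _ Aoo)//.
  by apply: le_measure; rewrite ?inE//; exact: measurableI.
by rewrite /= /mnormalize /= /mrestr setTI gt_eqF// lt_eqF//= /cond_measure EFinM fineK.
Qed.

(** * Partition entropies as integrals of label information *)

Section quasi_finite_entropy.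
Context {d : measure_display} {X : measurableType d} {R : realType}.
Context {m : {measure set X -> \bar R}} {T : X -> X} {A : set X} {xi : set (set X)}.
Hypothesis Tmp : measure_preserving m T.
Hypothesis Tcons : conservative m T.
Hypothesis Terg : ergodic m T.
Hypothesis mA : measurable A.
Hypothesis A_fin : (0 < m A < +oo)%E.
Hypothesis xi_part : countable_partition xi.
Variable code : set X -> nat.
Hypothesis code_inj : {in xi &, injective code}.
Variable P : probability X R.
Hypothesis PE : forall B, measurable B -> P B = (cond_measure m A B)%:E.

Let S := induced T A.
Let b := pblock xi id.
Let Smp : measure_preserving P S := induced_measure_preserving Tmp Tcons Terg mA A_fin PE.
Let Z := A `&` recurrent T A.

Let mZ : measurable Z.
Proof. by apply: measurableI => //; exact: measurable_recurrent Tmp mA. Qed.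

Let Z0 : P (~` Z) = 0%E.
Proof. by rewrite probability_setC// (cond_conull Tmp Tcons Terg mA A_fin PE) subee. Qed.

Let Z_iter j x : Z x -> Z (iter j S x).
Proof.
move=> Zx; elim: j => //= j [_ rx]; split.
  exact: (induced_in (recurrent_return_time_gt0 rx)).
exact: recurrent_induced.
Qed.

Lemma return_block n : (0 < n)%N -> (A `&` (iter n T @^-1` A)) `\`
    \bigcup_(j in [set j | (1 <= j <= n.-1)%N]) (iter j T @^-1` A) =
  A `&` (return_time T A @^-1` [set n]).
Proof.
move=> n0; apply/seteqP; split => x.
  move=> [[Ax An] nA]; split => //; apply: return_timeE; split => // j /andP[j1 jn] Aj.
  by apply: nA; exists j => //=; rewrite j1 -ltnS prednK.
move=> [Ax /(@returns_atP _ T A x n n0)[_ An nA]]; split => // -[j /= /andP[j1 jn]].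
by apply: nA; rewrite j1 -(prednK n0) ltnS.
Qed.

Lemma measurable_return_partition c : return_partition T A c -> measurable c.
Proof.
move=> [n n1 ->]; rewrite return_block//.
by apply: measurableI => //; exact: measurable_return_time Tmp mA n.
Qed.

Lemma entropy_return_partition :
  entropy m A (return_partition T A) = (\int[P]_x (label_info P (return_time T A) x)%:E)%E.
Proof.
apply: (entropy_label_info PE (blk := fun x => A `&`
   (return_time T A @^-1` [set return_time T A x])) mZ Z0).
- exact: measurable_return_time Tmp mA.
- exact: measurable_return_partition.
- move=> x [Ax rx]; have x0 := recurrent_return_time_gt0 rx.
  by exists (return_time T A x) => //; rewrite return_block.
- by move=> x c _ [n n1 ->]; rewrite return_block// => -[_ /= <-].
- by move=> x y _ [Ay _]; split=> [[]|].
Qed.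

Lemma entropy_partition :
  entropy m A xi = (\int[P]_x (label_info P (code \o b) x)%:E)%E.
Proof.
have bP := pblockP xi_part.
apply: (entropy_label_info PE (Z := setT) (blk := b)) => //.
- by rewrite setCT measure0.
- exact: measurable_pblock_code.
- by have [] := xi_part.
- by move=> x _; have [] := bP x.
- by move=> x c _; exact: pblock_uniq.
- move=> x y _ _; split=> [/(pblock_eqP xi_part) /= yx|/= yx].
    by rewrite /b yx.
  by apply/(pblock_eqP xi_part)/code_inj; rewrite ?inE//; exact: (bP _).1.
Qed.

Lemma measurable_return_label k :
  measurable (return_label T A xi code @^-1` [set k]).
Proof.
rewrite (_ : _ @^-1` _ = return_time T A @^-1` [set k.1] `&` (code \o b) @^-1` [set k.2]).
  apply: measurableI; first exact: measurable_return_time Tmp mA _.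
  exact: measurable_pblock_code.
by case: k => i j; apply/seteqP; split => x /=; [move=> [<- <-]|move=> [<- <-]].
Qed.

(** The return partition covers only the points of [A] that come back, so blocks and words are
    matched on [Z], which [S] maps into itself. *)
Lemma entropy_join_over n :
  entropy m A (join_over S (join_partition (return_partition T A) (restr_partition xi A))
    [set j | (j < n)%N]) =
  (\int[P]_x (word_info (P := P) (S := S) (return_label T A xi code) n x)%:E)%E.
Proof.
have bP := pblockP xi_part.
pose piece x := (A `&` (return_time T A @^-1` [set return_time T A x])) `&` (b x `&` A).
pose blk x := \bigcap_(j in [set j | (j < n)%N]) (iter j S @^-1` piece (iter j S x)).
have mw := measurable_word Smp measurable_return_label n.
have -> : (fun x => (word_info (P := P) (S := S) (return_label T A xi code) n x)%:E) =
    (fun x => (label_info P (word (S := S) (return_label T A xi code) n) x)%:E).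
  by apply/funext => x; rewrite /label_info (word_probE Smp measurable_return_label).
apply: (entropy_label_info PE (blk := blk) mZ Z0 mw).
- move=> _ [a [aP ->]]; rewrite bigcap_mkcond; apply: bigcapT_measurable => j.
  case: ifPn => // /set_mem /aP [r [_ [rP [c xic <-] ->]]].
  apply: (measurable_preimage_iter Smp).
  apply: measurableI; first exact: measurable_return_partition.
  by apply: measurableI => //; have [_ + _ _] := xi_part; exact.
- move=> x Zx; exists (fun j => piece (iter j S x)); split => // j _.
  have [Aj rj] := Z_iter j Zx; have j0 := recurrent_return_time_gt0 rj.
  exists (A `&` (return_time T A @^-1` [set return_time T A (iter j S x)])).
  exists (b (iter j S x) `&` A); split => //.
    by exists (return_time T A (iter j S x)) => //; rewrite return_block.
  by exists (b (iter j S x)) => //; exact: (bP _).1.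
- move=> x c Zx [a [aP ->]] ax; apply: eq_bigcapr => j jn; congr (_ @^-1` _).
  have := ax j jn; have [r [_ [[k k1 ->] [e xie <-] ->]]] := aP j jn.
  rewrite return_block// /piece => -[[_ /= <-] [ej _]].
  by rewrite (pblock_uniq xi_part xie ej).
- move=> x y Zx Zy; rewrite word_eqP; split=> [h j jn|h j jn].
    have [[_ /= rj] [bj _]] := h j jn; rewrite /return_label rj; congr (_, code _).
    exact/pblock_eqP.
  have [rj cj] := h j jn; have [Aj _] := Z_iter j Zy; split; split => //.
  apply/(pblock_eqP xi_part); apply: code_inj; rewrite ?inE//; exact: (bP _).1.
Qed.

Lemma information_lty : quasi_finite_set m T A -> (entropy m A xi < +oo)%E ->
  (\int[P]_x (word_info (P := P) (S := S) (return_label T A xi code) 1 x)%:E < +oo)%E.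
Proof.
move=> [_ _ rho_fin] xi_fin.
have := @pair_label_info_lty _ _ _ P _ _ (return_time T A) (code \o b).
move=> /(_ (measurable_return_time Tmp mA) (measurable_pblock_code xi_part code_inj)).
rewrite -entropy_return_partition -entropy_partition => /(_ rho_fin xi_fin).
apply: le_lt_trans; rewrite le_eqVlt; apply/orP; left; apply/eqP.
apply: eq_integral => x _; rewrite /label_info.
have /(congr1 fine)/= wE := word_probE Smp measurable_return_label 1 x.
rewrite /word_info -wE.
congr (- ln (fine (P _)))%:E; apply/seteqP; split => y /=.
  by move=> [h1 h2]; rewrite h1 /= h2.
by move=> [h1 h2]; rewrite /word /= /return_label h1; congr [:: (_, _)].
Qed.

End quasi_finite_entropy.

(** * Measure of the visit cells *)

Section visit_cells.
Context {d : measure_display} {X : measurableType d} {R : realType}.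
Context {m : {measure set X -> \bar R}} {T : X -> X} {A : set X} {xi : set (set X)}.
Hypothesis Tmp : measure_preserving m T.
Hypothesis Tcons : conservative m T.
Hypothesis Terg : ergodic m T.
Hypothesis mA : measurable A.
Hypothesis A_fin : (0 < m A < +oo)%E.
Hypothesis xi_part : countable_partition xi.
Variable code : set X -> nat.
Hypothesis code_inj : {in xi &, injective code}.
Variable P : probability X R.
Hypothesis PE : forall B, measurable B -> P B = (cond_measure m A B)%:E.

Let S := induced T A.
Let lab := return_label T A xi code.
Let Smp : measure_preserving P S := induced_measure_preserving Tmp Tcons Terg mA A_fin PE.
Let mlab := measurable_return_label Tmp mA xi_part code_inj.
Let wprob k x := word_prob (P := P) (S := S) lab (word (S := S) lab k x).

Let measurable_word_S k s : measurable ((word (S := S) lab k \o S) @^-1` [set s]).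
Proof.
rewrite comp_preimage -[X in measurable X]setTI.
exact: (measurable_induced Tmp mA measurableT (measurable_word Smp mlab k s)).
Qed.

Lemma measurable_visit_cell k x : measurable (visit_cell T A xi code k x).
Proof.
rewrite (_ : visit_cell T A xi code k x =
  return_time T A @^-1` [set return_time T A x] `&`
  (word (S := S) lab k \o S) @^-1` [set word (S := S) lab k (S x)])//.
by apply: measurableI => //; exact: measurable_return_time Tmp mA _.
Qed.

(** On the cell of [x], [S] is a fixed iterate of [T], so the cell lies in a preimage, of equal
    measure, of the points of [A] carrying the word. *)
Lemma visit_cell_le k x : recurrent T A x ->
  (m (visit_cell T A xi code k x) <= (fine (m A) * wprob k (S x))%:E)%E.
Proof.
move=> rx; set r := return_time T A x.
have mW : measurable (word (S := S) lab k @^-1` [set word (S := S) lab k (S x)]).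
  exact: (measurable_word Smp mlab).
rewrite EFinM -(word_probE Smp mlab) -(measure_capE mA A_fin PE)//.
rewrite -[leRHS](measure_preimage_iter Tmp r); last exact: measurableI.
apply: le_measure; rewrite ?inE; first exact: measurable_visit_cell.
  by apply: (measurable_preimage_iter Tmp); exact: measurableI.
move=> y [yx wy]; have Sy : S y = iter r T y by rewrite /S /induced yx.
split; rewrite /preimage/= -Sy; first exact: wy.
by apply: induced_in; rewrite yx; exact: recurrent_return_time_gt0.
Qed.

(* On each level set of the return time, m is finite and Borel-Cantelli compares
   the law of the word seen after the first entrance with the law under P. *)
Lemma visit_cell_ge : {ae m, forall x, \forall k \near \oo,
  wprob k (S x) <= k%:R ^+ 2 * fine (m (visit_cell T A xi code k x))}.
Proof.
pose L r := return_time T A @^-1` [set r].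
have mL r : measurable (L r) by exact: measurable_return_time Tmp mA r.
pose g (k : nat) (s : seq (nat * nat)) : R :=
  if size s == k then word_prob (P := P) (S := S) lab s else 0.
have g0 k s : 0 <= g k s by rewrite /g; case: ifP => // _; exact: word_prob_ge0.
have g1 k : (\esum_(s in [set: seq (nat * nat)]) (g k s)%:E <= 1)%E.
  apply: le_trans (word_prob_mass Smp mlab k).
  rewrite [leRHS]esum_mkcond; apply: le_esum => s _; rewrite /g.
  case: ifPn => [/eqP sn|sn]; first by rewrite mem_set.
  by rewrite memNset//; apply/eqP.
have level r : {ae m, forall x, return_time T A x = r.+1 -> \forall k \near \oo,
    wprob k (S x) <= k%:R ^+ 2 * fine (m (visit_cell T A xi code k x))}.
  have muoo : (mrestr m (mL r.+1) setT < +oo)%E.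
    rewrite /mrestr setTI; case/andP : A_fin => _; apply: le_lt_trans.
    rewrite -(measure_preimage_iter Tmp r.+1 mA); apply: le_measure; rewrite ?inE//.
      exact: (measurable_preimage_iter Tmp).
    by move=> x /(@returns_atP _ T A x r.+1 isT)[].
  have [N [mN N0 HN]] := ae_weight_le_density measurable_word_S g0 muoo g1.
  exists (N `&` L r.+1); split => //; first exact: measurableI.
  move=> x /= h; split; last by apply: contrapT => h'; apply: h => rx; exfalso; exact: h'.
  apply: HN => /= h'; apply: h => rx; apply: filterS h' => k.
  rewrite /g size_word eqxx /mrestr; congr (_ <= _ * fine (m _)).
  by apply/seteqP; split => y; rewrite /L/= -rx => -[].
have {}level : {ae m, forall x, forall r, return_time T A x = r.+1 -> \forall k \near \oo,
    wprob k (S x) <= k%:R ^+ 2 * fine (m (visit_cell T A xi code k x))}.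
  exact: ae_foralln.
apply: filterS2 (recurrent_ae Tmp Tcons Terg mA A_fin) level => x rx h.
apply: (h (return_time T A x).-1); rewrite prednK//.
exact: recurrent_return_time_gt0.
Qed.

End visit_cells.

(** * Number of visits compared with the sums of [p] *)

Section visit_ratio.
Context {d : measure_display} {X : measurableType d} {R : realType}.
Context {m : {measure set X -> \bar R}} {T : X -> X} {A : set X} {p : X -> R}.
Hypothesis Tmp : measure_preserving m T.
Hypothesis Tcons : conservative m T.
Hypothesis Terg : ergodic m T.
Hypothesis mA : measurable A.
Hypothesis A_fin : (0 < m A < +oo)%E.
Hypothesis p_int : m.-integrable setT (EFin \o p).
Hypothesis p_int1 : (\int[m]_x (p x)%:E = 1)%E.

Lemma visit_count_sum n x :
  birkhoff_sum T (\1_A : X -> R) n x + \1_A (iter n T x) = \1_A x + (visit_count T A n x)%:R.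
Proof.
rewrite -birkhoff_sumSr birkhoff_sumSl; congr (_ + _).
rewrite /visit_count big_add1/= natr_sum /birkhoff_sum; apply: eq_bigr => j _.
by rewrite indicE -iterSr.
Qed.

Lemma visit_count_ge k n x : recurrent T A x -> (visit_time T A k x <= n)%N ->
  (k <= visit_count T A n x)%N.
Proof.
move=> rx kn; rewrite leqNgt; apply/negP => lt.
have /andP[_] := visit_count_time n rx; rewrite ltnNge => /negP; apply.
exact: leq_trans (visit_time_le _ _ _ lt) kn.
Qed.

Lemma visit_count_cvg x : recurrent T A x -> visit_count T A n x @[n --> \oo] --> \oo.
Proof.
move=> rx; apply/cvgnyPge => k; exists (visit_time T A k x) => // n /= kn.
exact: visit_count_ge.
Qed.

Let indA_int : m.-integrable setT (EFin \o (\1_A : X -> R)).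
Proof.
apply/integrableP; split; first exact/measurable_EFinP/measurable_indic.
under eq_integral do rewrite gee0_abs ?lee_fin//.
by rewrite integral_indic// setIT; case/andP: A_fin.
Qed.

Let indA_E : (\int[m]_x (\1_A x : R)%:E = (fine (m A))%:E)%E.
Proof.
rewrite integral_indic// setIT fineK// ge0_fin_numE//; by case/andP: A_fin.
Qed.

(** Recurrence makes the sums of the indicator of [A] diverge, and they are at most a multiple of
    those of [p] plus a constant; the slope [m A + 1] exceeds the ratio of the integrals. *)
Lemma birkhoff_sum_cvgy : {ae m, forall x, birkhoff_sum T p n x @[n --> \oo] --> +oo}.
Proof.
have c0 : 0 < fine (m A) by exact: cond_measure_mass.
have H : {ae m, forall x, exists K : R, forall n,
    birkhoff_sum T (\1_A : X -> R) n x <= (fine (m A) + 1) * birkhoff_sum T p n x + K}.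
  apply: (birkhoff_sum_le_scale Tmp Terg indA_int p_int).
  by rewrite indA_E p_int1 mule1 lte_fin ltrDl.
apply: filterS2 (recurrent_ae Tmp Tcons Terg mA A_fin) H => x rx [K hK].
apply/cvgryPge => M.
(* Enough visits to exceed the target and the constant [K]; the summand 1 pays for the endpoint by
   which the visit count and the Birkhoff sum differ. *)
pose k := (Num.trunc ((fine (m A) + 1) * `|M| + `|K| + 1)).+1.
exists (visit_time T A k x) => // n /= kn.
have cn := visit_count_ge rx kn; have := visit_count_sum n x; have h := hK n.
have h1 := truncnS_gt ((fine (m A) + 1) * `|M| + `|K| + 1).
have h2 : k%:R <= (visit_count T A n x)%:R :> R by rewrite ler_nat.
have i0 : 0 <= \1_A x :> R by rewrite indicE.
have i1 : \1_A (iter n T x) <= 1 :> R by rewrite indicE; case: (_ \in _).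
have K1 := ler_norm K; have M1 := ler_norm M.
rewrite -/k in h1.
have cc : 0 < fine (m A) + 1 by lra.
move=> vs; rewrite -(ler_pM2l cc).
have : (fine (m A) + 1) * M <= (fine (m A) + 1) * `|M| by rewrite ler_pM2l.
by clear p_int1 A_fin indA_E; lra.
Qed.

Lemma visit_count_ratio : {ae m, forall x,
  (visit_count T A n x)%:R / birkhoff_sum T p n x @[n --> \oo] --> fine (m A)}.
Proof.
have H := birkhoff_ratio_cvg Tmp Terg indA_int p_int p_int1 birkhoff_sum_cvgy.
apply: filterS2 birkhoff_sum_cvgy H => x py.
rewrite indA_E /= => H.
pose r n := (\1_A (iter n T x) - \1_A x : R) / birkhoff_sum T p n x.
have -> : (fun n => (visit_count T A n x)%:R / birkhoff_sum T p n x) =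
    (fun n => birkhoff_sum T (\1_A : X -> R) n x / birkhoff_sum T p n x + r n).
  apply/funext => n; rewrite /r -mulrDl; congr (_ / _).
  by have := visit_count_sum n x => vs; lra.
rewrite -[X in _ --> X]addr0; apply: cvgD => //.
have pos : \forall n \near \oo, 0 < birkhoff_sum T p n x by move/cvgryPgt : py; exact.
have inv0 : (birkhoff_sum T p n x)^-1 @[n --> \oo] --> (0 : R) by apply/gtr0_cvgV0.
have Ninv0 : - (birkhoff_sum T p n x)^-1 @[n --> \oo] --> (0 : R).
  by rewrite -[X in _ --> X]oppr0; exact: cvgN.
apply: squeeze_cvgr Ninv0 inv0; apply: filterS pos => n s0.
have i0 : `|\1_A (iter n T x) - \1_A x| <= 1 :> R.
  by rewrite !indicE; do 2 case: (_ \in _); rewrite ?subrr ?subr0 ?sub0r ?normrN ?normr0 ?normr1.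
move: i0; rewrite ler_norml /r => /andP[l u].
apply/andP; split; first by rewrite -[leLHS]mulN1r ler_pM2r ?invr_gt0.
by rewrite -[leRHS]mul1r ler_pM2r ?invr_gt0.
Qed.

End visit_ratio.

(** * Passage to the limit along the visit counts *)

Section final_limit.
Context {R : realType}.

(** Makes the loss of one letter in the outer cell harmless. *)
Lemma cvg_div_pred (u : nat -> R) (h : R) :
  u n / n%:R @[n --> \oo] --> h -> u n.-1 / n%:R @[n --> \oo] --> h.
Proof.
move=> uh; rewrite -cvg_shiftS /=.
have H : (u n / n%:R - u n / n%:R * harmonic n) @[n --> \oo] --> h.
  rewrite -[X in _ --> X]subr0 -[X in _ --> _ - X](mulr0 h).
  by apply: cvgB => //; apply: cvgM => //; exact: cvg_harmonic.
apply: cvg_trans H; apply: near_eq_cvg.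
exists 1%N => // n /= n1; rewrite /harmonic/=.
have n0 : n%:R != 0 :> R by rewrite pnatr_eq0 -lt0n.
have -> : n.+1%:R = n%:R + 1 :> R by rewrite natr1.
by field; rewrite n0 natr1 pnatr_eq0.
Qed.

Lemma cvg_cst_div_nat (c : R) : c / n%:R @[n --> \oo] --> (0 : R).
Proof.
rewrite -[X in _ --> X](mulr0 c); apply: cvgMr.
rewrite gtr0_cvgV0; first exact: cvgr_idn.
by exists 1%N => // n /= n0; rewrite ltr0n.
Qed.

End final_limit.

Theorem proposition4p1 (d : measure_display) (X : measurableType d)
    (R : realType) (m : {sigma_finite_measure set X -> \bar R})
    (T : X -> X) (xi : set (set X)) (A : set X) (p : X -> R)
    (Tmp : measure_preserving m T) (Tcons : conservative m T)
    (Terg : ergodic m T)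
    (xiqf : quasi_finite_partition m T xi A)
    (p_int : m.-integrable setT (EFin \o p))
    (p_gt0 : {ae m, forall x, 0 < p x})
    (p_int1 : (\int[m]_x (p x)%:E = 1)%E) :
  {ae m, forall x,
    (fun n : nat => (((birkhoff_sum T p n x)^-1)%:E *
                     information m (itinerary T xi 1 n) x)%E) @ \oo
      --> krengel_entropy m T xi A}.
Proof.
have [[xi_part mA A_fin xiA] A_qf xi_fin] := xiqf.
have [xi_count _ _ _] := xi_part.
have /countable_injP[code code_inj] := xi_count.
have [P PE] := cond_probability_exists mA A_fin.
have Smp := induced_measure_preserving Tmp Tcons Terg mA A_fin PE.
have Serg := induced_ergodic Tmp Tcons Terg mA A_fin PE.
have mlab := measurable_return_label Tmp mA xi_part code_inj.
have info1 := information_lty Tmp Tcons Terg mA A_fin xi_part code_inj PE A_qf xi_fin.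
have [h [Hh Ih]] := shannon_mcmillan_breiman Smp Serg mlab info1.
have -> : krengel_entropy m T xi A = (h * fine (m A))%:E.
  have hE : mean_entropy m A (induced T A) (join_partition (return_partition T A)
      (restr_partition xi A)) = h%:E.
    apply/cvg_lim => //; apply: cvg_trans Hh; apply: near_eq_cvg; apply: nearW => n.
    by rewrite (entropy_join_over Tmp Tcons Terg mA A_fin xi_part code_inj PE).
  rewrite /krengel_entropy hE EFinM muleC fineK// ge0_fin_numE//.
  by case/andP: A_fin.
have {}Ih := ae_induced Tmp Tcons Terg mA A_fin PE Ih.
have wp := ae_induced Tmp Tcons Terg mA A_fin PE (word_prob_gt0_ae Smp mlab).
have cell := visit_cell_ge Tmp Tcons Terg mA A_fin xi_part code_inj PE.
have rec := recurrent_ae Tmp Tcons Terg mA A_fin.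
have ratio := visit_count_ratio Tmp Tcons Terg mA A_fin p_int p_int1.
have py := birkhoff_sum_cvgy Tmp Tcons Terg mA A_fin p_int p_int1.
clear p_gt0 p_int p_int1 info1 Hh xiqf A_qf xi_fin.
apply: filterS3 rec cell (filterI Ih (filterI wp (filterI ratio py))).
move=> x rx xcell [xh [xwp [xratio xpy]]].
pose S := induced T A.
pose lab := return_label T A xi code.
pose k n := visit_count T A n x.
pose B n := pblock (itinerary T xi 1 n) id x.
pose I j : R := word_info (P := P) (S := S) lab j (S x).
pose w j : R := word_prob (P := P) (S := S) lab (word (S := S) lab j (S x)).
have w0 j : 0 < w j by exact: xwp.
pose c : R := fine (m A); have c0 : 0 < c := cond_measure_mass A_fin.
have BE n := pblock_itinerary xi_part T n x.
have mB n : measurable (B n).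
  rewrite /B BE (_ : [set y | _] = \bigcap_(j in [set j | (1 <= j <= n)%N])
      (iter j T @^-1` pblock xi id (iter j T x))); last first.
    by apply/seteqP; split => y hy j jn; apply/(pblock_eqP xi_part)/hy.
  rewrite bigcap_mkcond; apply: bigcapT_measurable => j; case: ifP => // _.
  exact/(measurable_preimage_iter Tmp)/measurable_pblock.
have mcell j := measurable_visit_cell Tmp Tcons Terg mA A_fin xi_part code_inj PE j x.
have cell_le j := visit_cell_le Tmp Tcons Terg mA A_fin xi_part code_inj PE j rx.
have cell_fin j : m (visit_cell T A xi code j x) \is a fin_num.
  by rewrite ge0_fin_numE// (le_lt_trans (cell_le j))// ltry.
(* The [k n]-th visit has occurred by time [n] but its return time is not yet known, so only
   [k n - 1] letters are determined. *)
have B_le n : (0 < k n)%N -> (m (B n) <= (c * w (k n).-1)%:E)%E.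
  move=> k0; apply: le_trans (cell_le (k n).-1).
  apply: le_measure; rewrite ?inE//; rewrite /B BE => y.
  apply: (@sub_visit_cell _ _ T A xi code xi_part xiA (k n).-1 n x y rx); rewrite prednK//.
  by have /andP[] := visit_count_time n rx.
have B_ge n : (m (visit_cell T A xi code (k n) x) <= m (B n))%E.
  apply: le_measure; rewrite ?inE//; rewrite /B BE => y.
  apply: (@visit_cell_sub _ _ T A xi code xi_part xiA code_inj (k n) n x y).
  by have /andP[] := visit_count_time n rx.
have k_oo : k n @[n --> \oo] --> \oo := visit_count_cvg rx.
(* Bounds on the information of the block in terms of the number [j] of visits: [2 ln j] comes from
   [visit_cell_ge], and [ln c] from the mass of [A] in [visit_cell_le]. *)
pose U j : R := I j + (ln j%:R + ln j%:R).
pose L j : R := I j.-1 - ln c.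
have U_h : U j / j%:R @[j --> \oo] --> h.
  rewrite -[h]addr0 -[X in h + X](addr0 0).
  rewrite (_ : (fun j => _) = fun j => I j / j%:R + (ln j%:R / j%:R + ln j%:R / j%:R)).
    by apply: cvgD => //; apply: cvgD; exact: ln_nat_div_cvg0.
  by apply/funext => j; rewrite /U !mulrDl.
have L_h : L j / j%:R @[j --> \oo] --> h.
  rewrite -[h]subr0.
  rewrite (_ : (fun j => _) = fun j => I j.-1 / j%:R - ln c / j%:R).
    by apply: cvgB; [exact: cvg_div_pred|exact: cvg_cst_div_nat].
  by apply/funext => j; rewrite /L mulrBl.
have good : \forall n \near \oo, [/\ (0 < k n)%N, 0 < birkhoff_sum T p n x &
    w (k n) <= (k n)%:R ^+ 2 * fine (m (visit_cell T A xi code (k n) x))].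
  have g1 : \forall n \near \oo, (0 < k n)%N.
    by move/cvgnyPgt : k_oo; exact.
  have g2 : \forall n \near \oo, 0 < birkhoff_sum T p n x.
    by move/cvgryPgt : xpy; exact.
  have g3 := k_oo _ xcell.
  by apply: filterS3 g1 g2 g3 => n.
pose q n := fine (m (B n)).
(* From the first visit on, the block lies in a cell of finite measure, so the value [-oo] of the
   information occurs for finitely many [n] only. *)
have bounds : \forall n \near \oo, [/\ (0 < k n)%N, 0 < birkhoff_sum T p n x,
    m (B n) = (q n)%:E, 0 < q n & L (k n) <= - ln (q n) <= U (k n)].
  apply: filterS good => n [k0 p0 wc].
  have mBE : m (B n) = (q n)%:E.
    by rewrite fineK// ge0_fin_numE// (le_lt_trans (B_le n k0))// ltry.
  have kk : 0 < (k n)%:R :> R by rewrite ltr0n.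
  have k2 : 0 < (k n)%:R ^+ 2 :> R by rewrite exprn_gt0.
  have qw : w (k n) <= (k n)%:R ^+ 2 * q n.
    apply: le_trans wc _; by rewrite ler_pM2l// -lee_fin -mBE fineK// B_ge.
  have q0 : 0 < q n by rewrite -(pmulr_rgt0 _ k2); exact: lt_le_trans qw.
  split => //; apply/andP; split.
    have : ln (q n) <= ln (c * w (k n).-1).
      by rewrite ler_ln ?posrE ?mulr_gt0// -lee_fin -mBE B_le.
    by rewrite lnM ?posrE// /L /I /word_info -/(w _) => lnq; lra.
  have : ln (w (k n)) <= ln ((k n)%:R ^+ 2 * q n).
    by rewrite ler_ln ?posrE ?mulr_gt0.
  by rewrite expr2 !lnM ?posrE ?mulr_gt0// /U /I /word_info -/(w _) => lnq; lra.
have main : - ln (q n) / (k n)%:R @[n --> \oo] --> h.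
  have Lk : L (k n) / (k n)%:R @[n --> \oo] --> h by exact: cvg_comp k_oo L_h.
  have Uk : U (k n) / (k n)%:R @[n --> \oo] --> h by exact: cvg_comp k_oo U_h.
  apply: squeeze_cvgr Lk Uk.
  apply: filterS bounds => n [k0 _ _ _ /andP[l u]] /=.
  by rewrite !ler_pM2r ?invr_gt0 ?ltr0n// l u.
(* Information per visit times visits per unit of the sum of [p]; the visit count cancels. *)
have prod := cvgM main xratio.
apply: (@cvg_trans _ ((- ln (q n) / (k n)%:R *
    ((k n)%:R / birkhoff_sum T p n x))%:E @[n --> \oo])); last first.
  by apply: cvg_EFin; [exact: nearW|exact: prod].
apply: near_eq_cvg; apply: filterS bounds => n [k0 p0 mBE q0 _].
rewrite /information [X in (X^-1)%E](_ : _ = (q n)%:E); last exact: mBE.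
rewrite inver gt_eqF// lneV// lne_EFin// -EFinN -EFinM.
by congr (_%:E); field; rewrite gt_eqF//= pnatr_eq0 -lt0n.
Qed.
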